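(* Let $(X,d)$ be a proper metric space such that $\dim_{AN}X\le n$. Then there exists a constant $C>0$ (depending only on $X$) such that for every faithful nondegenerate representation of $C_0(X)$ on a Hilbert space $H$, every operator $T\in\mathbb{B}(H)$ and every $\alpha>0$, there exists $T'\in\mathbb{B}(H)$ such that $$\|T-T'\|<\alpha,\qquad \mathrm{prop}(T')\le C\,\frac{L^*(T)}{\alpha}.$$
   Context: Assouad–Nagata dimension: $\dim_{AN}X\le n$ if and only if there exists a constant $c>0$ such that for every $R>0$ there is a cover $\mathcal{U}$ of $X$ by sets of diameter at most $cR$ such that every ball of radius $R$ meets at most $n+1$ members of $\mathcal{U}$. $L=L_d$ denotes the Lipschitz constant: $L_d(f)=\sup_{x\ne y}|f(x)-f(y)|/d(x,y)\in[0,\infty]$. For a representation of $C_0(X)$ on $H$ (functions being identified with the operators by which they act, and unitizations acting unitally) and $T\in\mathbb{B}(H)$: Commutant seminorm: $L^*(T)=\sup\{\|[T,f]\|: f\in C_0(X)\text{ real-valued}, L_d(f)\le 1\}\in[0,\infty]$. Propagation: $\mathrm{prop}(T)$ is the infimum of the $R\ge 0$ such that $\chi_{(-\infty,0]}(f)\,T\,\chi_{(R,+\infty)}(f)=0$ for all self-adjoint $f$ in the unitization of $C_0(X)$ with $L_d(f)\le1$ (Borel functional calculus), with $\inf\emptyset=\infty$. *)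

(* Defs.v *)
From HB Require Import structures.
From mathcomp Require Import all_boot all_order all_algebra.
From mathcomp Require Import complex.
From mathcomp Require Import all_classical all_reals all_analysis.

Set Implicit Arguments.
Unset Strict Implicit.
Unset Printing Implicit Defensive.

Import Order.TTheory GRing.Theory Num.Theory Num.Def.
Import numFieldNormedType.Exports.

Local Open Scope classical_set_scope.
Local Open Scope ring_scope.

Section MetricSpaces.
Context {R : realType} {X : metricType R}.

Definition proper_metric : Prop :=
  forall (x : X) (r : R), compact [set y : X | mdist x y <= r].

(* For r > 0, [ball x r] is the open ball of radius r. *)
Definition assouad_nagata_dim_le (n : nat) : Prop :=
  exists2 c : R, 0 < c & forall r : R, 0 < r ->
    exists U : set (set X),
      [/\ \bigcup_(B in U) B = setT,
          forall B, U B -> forall x y, B x -> B y -> mdist x y <= c * r &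
          forall x : X, ([set B | U B /\ B `&` ball x r !=set0] #<= `I_n.+1)%card].

(* The value 0 is added so that the supremum lies in [0, +oo] even when X has
   at most one point. *)
Definition lipschitz_const (f : X -> R) : \bar R :=
  ereal_sup ([set 0%E] `|`
    [set (`|f p.1 - f p.2| / mdist p.1 p.2)%:E
       | p in [set p : X * X | p.1 <> p.2]]).

(* The type R[i] carries its topology through the alias R[i]^o. *)
Definition C0 (f : X -> R[i]) : Prop :=
  continuous (f : X -> R[i]^o) /\
  forall e : R[i], 0 < e ->
    exists2 K : set X, compact K & forall x, ~ K x -> `|f x| < e.

Definition complexify (f : X -> R) : X -> R[i] := fun x => (f x)%:C%C.

End MetricSpaces.
Arguments proper_metric {R} X.
Arguments assouad_nagata_dim_le {R} X n.

Section Operators.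
Context {R : realType} {H : completeNormedModType R[i]}.

(* Norms on H take their values in R[i]; they are real and nonnegative, so
   [complex.Re] recovers them as elements of R. *)
Definition opnorm (T : H -> H) : \bar R :=
  ereal_sup [set (complex.Re `|T v|)%:E | v in [set v : H | `|v| <= 1]].

Definition bounded_operator (T : H -> H) : Prop :=
  linear T /\ (opnorm T < +oo)%E.

Variable dot : {dot H for @conjC R[i]}.

Definition induces_norm : Prop := forall v : H, dot v v = `|v| ^+ 2.

Definition orthogonal_projection (P : H -> H) : Prop :=
  [/\ bounded_operator P,
      forall v, P (P v) = P v &
      forall v w, dot (P v) w = dot v (P w)].

Definition scalar_spectral_measure (E : set R -> H -> H) (v : H)
    (mu : {measure set R -> \bar R}) : Prop :=
  forall B : set R, measurable B -> mu B = (complex.Re (dot (E B v) v))%:E.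

(* Weak countable additivity (each B |-> <E B v, v> is a measure) is equivalent
   to strong countable additivity, by polarization. *)
Record projection_valued_measure (E : set R -> H -> H) : Prop := {
  pvm_projection : forall B, measurable B -> orthogonal_projection (E B) ;
  pvm_setT : forall v, E setT v = v ;
  pvm_setI : forall B C, measurable B -> measurable C ->
    forall v, E (B `&` C) v = E B (E C v) ;
  pvm_sigma_additive : forall v, exists mu, scalar_spectral_measure E v mu
}.

(* A is the integral of t with respect to E; the spectrum of a bounded
   operator being bounded, so is the support of E. *)
Record spectral_resolution (A : H -> H) (E : set R -> H -> H) : Prop := {
  resolution_pvm : projection_valued_measure E ;
  resolution_bounded : exists M : R, forall v, E (~` `[- M, M]) v = 0 ;
  resolution_integral : forall v mu, scalar_spectral_measure E v mu ->
    dot (A v) v = (\int[mu]_t t)%:C%C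
}.

Definition is_borel_calculus (A : H -> H) (phi : R -> R) (S : H -> H) : Prop :=
  bounded_operator S /\
  exists2 E : set R -> H -> H, spectral_resolution A E &
    forall v mu, scalar_spectral_measure E v mu ->
      dot (S v) v = (\int[mu]_t phi t)%:C%C.

(* phi(A) for A bounded self-adjoint and phi bounded Borel: by the spectral
   theorem exactly one operator satisfies [is_borel_calculus A phi], so the
   default value of [xget] plays no role. *)
Definition borel_calculus (A : H -> H) (phi : R -> R) : H -> H :=
  xget (fun=> 0) [set S | is_borel_calculus A phi S].

End Operators.

Section Representations.
Context {R : realType} {X : metricType R} {H : completeNormedModType R[i]}.
Variables (dot : {dot H for @conjC R[i]}) (pi : (X -> R[i]) -> H -> H).

(* A representation is given on all functions X -> R[i], but only its values
   on C_0(X) are constrained or used. *)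
Record representation : Prop := {
  rep_bounded : forall f, C0 f -> bounded_operator (pi f) ;
  rep_linear : forall (a : R[i]) f g, C0 f -> C0 g -> forall v,
    pi (fun x => a * f x + g x) v = a *: pi f v + pi g v ;
  rep_mul : forall f g, C0 f -> C0 g -> forall v,
    pi (fun x => f x * g x) v = pi f (pi g v) ;
  rep_star : forall f, C0 f -> forall v w,
    dot (pi (fun x => conjC (f x)) v) w = dot v (pi f w)
}.

Definition faithful : Prop :=
  forall f, C0 f -> (forall v, pi f v = 0) -> forall x, f x = 0.

Definition nondegenerate_rep : Prop :=
  dense [set w : H | exists (m : nat) (f : 'I_m -> X -> R[i]) (v : 'I_m -> H),
    (forall i, C0 (f i)) /\ w = \sum_(i < m) pi (f i) (v i)].

Definition commutator_seminorm (T : H -> H) : \bar R :=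
  ereal_sup
    [set opnorm (fun v => T (pi (complexify f) v) - pi (complexify f) (T v))
       | f in [set f : X -> R |
           C0 (complexify f) /\ (lipschitz_const f <= 1)%E]].

(* The operator by which the element g + l of the unitization acts. *)
Definition unitization_act (g : X -> R) (l : R) : H -> H :=
  fun v => pi (complexify g) v + l%:C%C *: v.

(* The self-adjoint elements of the unitization are the functions g + l with
   g in C_0(X) real-valued and l real. *)
Definition propagation (T : H -> H) : \bar R :=
  ereal_inf [set r%:E | r in [set r : R | 0 <= r /\
    forall (g : X -> R) (l : R), C0 (complexify g) ->
      (lipschitz_const (fun x => (g x + l)%R) <= 1)%E ->
      forall v : H,
        borel_calculus dot (unitization_act g l) (\1_(`]-oo, 0]))
          (T (borel_calculus dot (unitization_act g l) (\1_(`]r, +oo[)) v))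
        = 0]].

End Representations.

(* Main.v *)
Require Import Defs.
From HB Require Import structures.
From mathcomp Require Import all_boot all_order all_algebra.
From mathcomp Require Import complex ring lra finmap.
From mathcomp Require Import all_classical all_reals all_analysis.
From mathcomp Require Import measurable_realfun.

(** Take a cover at scale r of multiplicity n+1, cut-offs q_B equal to 1 near B
    and supported in the r-neighbourhood of B, a partition of unity p_B with
    p_B q_B = p_B, and put T' := \sum_B p_B T q_B (a strong limit of finite sums).
    - T' - T = \sum_B p_B [T, q_B].  By Cauchy-Schwarz its norm is controlled by
      \sum_B |[T, q_B] v|^2, and for suitable signs eps_B this is at most
      |[T, \sum_B eps_B q_B] v|^2, where \sum_B eps_B q_B is O(n/r)-Lipschitz
      because at most 2(n+1) terms matter at two given points.  So
      |T - T'| = O(n L^*(T) / r), and r is chosen proportional to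
      n L^*(T) / alpha.
    - The support of q_B has diameter O(r).  A function g + l of Lipschitz
      constant at most 1 is therefore either positive on supp p_B or smaller
      than O(r) on supp q_B, so every term p_B T q_B is killed on the left or on
      the right by the spectral projections.  That a projection E(B) kills
      functions living where g + l avoids B is shown by comparing the growth of
      the powers of an affine function of the operator; only the integral
      formula for the quadratic form is needed, not the spectral theorem. *)

Set Implicit Arguments.
Unset Strict Implicit.
Unset Printing Implicit Defensive.

Import Order.TTheory GRing.Theory Num.Theory Num.Def.
Import numFieldNormedType.Exports.

Local Open Scope classical_set_scope.
Local Open Scope ring_scope.

(** * Real Hilbert space structure *)

Section Hilbert.
Context {R : realType} {H : completeNormedModType R[i]}.
Variable dot : {dot H for @conjC R[i]}.
Hypothesis hdot : induces_norm dot.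

Definition nrm (v : H) : R := complex.Re `|v|.
Definition rdot (v w : H) : R := complex.Re (dot v w).

Lemma Re_conjC (x : R[i]) : complex.Re (x^*) = complex.Re x.
Proof. by apply: complexI; rewrite !complexRe Re_conj. Qed.

Lemma nrmE (v : H) : `|v| = (nrm v)%:C%C.
Proof. by rewrite /nrm RRe_real// normr_real. Qed.

Lemma nrm_ge0 (v : H) : 0 <= nrm v.
Proof. by rewrite -ler0c -nrmE. Qed.

Lemma nrm_eq0 (v : H) : nrm v = 0 -> v = 0.
Proof. by move=> h; apply/normr0_eq0; rewrite nrmE h. Qed.

Lemma nrm0 : nrm 0 = 0. Proof. by rewrite /nrm normr0. Qed.

Lemma nrmN (v : H) : nrm (- v) = nrm v. Proof. by rewrite /nrm normrN. Qed.

Lemma nrmD (v w : H) : nrm (v + w) <= nrm v + nrm w.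
Proof. by rewrite -lecR rmorphD/= -!nrmE ler_normD. Qed.

Lemma nrmZ (a : R) (v : H) : nrm (a%:C%C *: v) = `|a| * nrm v.
Proof.
apply: complexI; rewrite rmorphM/= -!nrmE normrZ; congr (_ * _).
by rewrite normc_def/= expr0n addr0 sqrtr_sqr.
Qed.

Lemma rdotC (v w : H) : rdot v w = rdot w v.
Proof. by rewrite /rdot hermC/= expr0 mul1r Re_conjC. Qed.

Lemma rdotDl (u v w : H) : rdot (u + v) w = rdot u w + rdot v w.
Proof. by rewrite /rdot linearDl/= raddfD. Qed.

Lemma rdotDr (u v w : H) : rdot w (u + v) = rdot w u + rdot w v.
Proof. by rewrite rdotC rdotDl !(rdotC w). Qed.

Lemma rdotZl (a : R) (v w : H) : rdot (a%:C%C *: v) w = a * rdot v w.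
Proof.
by rewrite /rdot linearZl_LR/=; case: (dot v w) => x y /=; rewrite mul0r subr0.
Qed.

Lemma rdotZr (a : R) (v w : H) : rdot w (a%:C%C *: v) = a * rdot w v.
Proof. by rewrite rdotC rdotZl rdotC. Qed.

Lemma rdotNl (v w : H) : rdot (- v) w = - rdot v w.
Proof. by rewrite /rdot linearNl/= raddfN. Qed.

Lemma rdotNr (v w : H) : rdot w (- v) = - rdot w v.
Proof. by rewrite rdotC rdotNl rdotC. Qed.

Lemma rdotBl (u v w : H) : rdot (u - v) w = rdot u w - rdot v w.
Proof. by rewrite rdotDl rdotNl. Qed.

Lemma rdotBr (u v w : H) : rdot w (u - v) = rdot w u - rdot w v.
Proof. by rewrite rdotDr rdotNr. Qed.

Lemma rdot0l (w : H) : rdot 0 w = 0.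
Proof. by rewrite -(subrr 0) rdotBl subrr. Qed.

Lemma rdot_suml I (s : seq I) (f : I -> H) w :
  rdot (\sum_(i <- s) f i) w = \sum_(i <- s) rdot (f i) w.
Proof.
elim: s => [|i s ih]; first by rewrite !big_nil rdot0l.
by rewrite !big_cons rdotDl ih.
Qed.

Lemma rdotvv (v : H) : rdot v v = nrm v ^+ 2.
Proof. by apply: complexI; rewrite /rdot hdot rmorphXn/= -nrmE nrmE -rmorphXn. Qed.

(** Expanding the square of |w| v - |v| w leaves 2 |v| |w| (|v| |w| - <v, w>); zero vectors are set
    aside so that the positive factor can be cancelled. *)
Lemma rdot_le (v w : H) : rdot v w <= nrm v * nrm w.
Proof.
have [w0|] := eqVneq (nrm w) 0.
  by rewrite (nrm_eq0 w0) rdotC rdot0l nrm0 mulr0.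
have [v0|] := eqVneq (nrm v) 0.
  by rewrite (nrm_eq0 v0) rdot0l nrm0 mul0r.
move=> /eqP v0 /eqP w0.
have hv : 0 < nrm v by rewrite lt_neqAle nrm_ge0 andbT eq_sym; exact/eqP.
have hw : 0 < nrm w by rewrite lt_neqAle nrm_ge0 andbT eq_sym; exact/eqP.
have : 0 <= rdot ((nrm w)%:C%C *: v - (nrm v)%:C%C *: w)
                ((nrm w)%:C%C *: v - (nrm v)%:C%C *: w).
  by rewrite rdotvv sqr_ge0.
rewrite !(rdotBl, rdotBr, rdotZl, rdotZr) !rdotvv (rdotC w v) => h.
have : 0 <= nrm w * nrm v * (nrm v * nrm w - rdot v w) by nra.
by rewrite pmulr_rge0 ?mulr_gt0// subr_ge0.
Qed.

Lemma rdot_eq0 (v : H) : (forall w, rdot v w = 0) -> v = 0.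
Proof.
move=> h; apply: nrm_eq0; apply/eqP.
by rewrite -sqrf_eq0 -rdotvv h.
Qed.

Lemma nrm_le_rdot (v : H) (c : R) : 0 <= c ->
  (forall w, rdot v w <= c * nrm w) -> nrm v <= c.
Proof.
move=> c0 /(_ v); rewrite rdotvv expr2 => h.
have [v0|v0] := eqVneq (nrm v) 0; first by rewrite v0.
by rewrite ler_pM2r in h => //; rewrite lt_neqAle nrm_ge0 eq_sym v0.
Qed.

Lemma sum_CauchySchwarz I (s : seq I) (a b : I -> R) (A B : R) :
  0 <= A -> 0 <= B ->
  \sum_(i <- s) a i ^+ 2 <= A ^+ 2 -> \sum_(i <- s) b i ^+ 2 <= B ^+ 2 ->
  \sum_(i <- s) a i * b i <= A * B.
Proof.
move=> A0 B0 hA hB.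
have sq0 : forall f : I -> R, 0 <= \sum_(i <- s) f i ^+ 2.
  by move=> f; apply: sumr_ge0 => i _; exact: sqr_ge0.
have zero : forall f g : I -> R, \sum_(i <- s) f i ^+ 2 <= 0 ->
    \sum_(i <- s) f i * g i = 0.
  move=> f g hf; elim: s hf {hA hB sq0} => [|i s ih]; first by rewrite !big_nil.
  rewrite !big_cons => hf.
  have h1 := sqr_ge0 (f i).
  have h2 : 0 <= \sum_(j <- s) f j ^+ 2 by apply: sumr_ge0 => j _; exact: sqr_ge0.
  have -> : f i = 0 by apply/eqP; rewrite -sqrf_eq0; apply/eqP; lra.
  by rewrite mul0r add0r ih//; lra.
have [A00|A1] := eqVneq A 0.
  by rewrite zero ?A00 ?mul0r// (le_trans hA)// A00 expr0n.
have [B00|B1] := eqVneq B 0.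
  under eq_bigr do rewrite mulrC.
  by rewrite zero ?B00 ?mulr0// (le_trans hB)// B00 expr0n.
have Ap : 0 < A by rewrite lt_neqAle A0 eq_sym A1.
have Bp : 0 < B by rewrite lt_neqAle B0 eq_sym B1.
have h : 0 <= \sum_(i <- s) (B * a i - A * b i) ^+ 2.
  by apply: sumr_ge0 => i _; exact: sqr_ge0.
have e : \sum_(i <- s) (B * a i - A * b i) ^+ 2 =
   B ^+ 2 * \sum_(i <- s) a i ^+ 2 + A ^+ 2 * \sum_(i <- s) b i ^+ 2
   - 2 * A * B * \sum_(i <- s) a i * b i.
  rewrite !mulr_sumr -big_split/= -sumrB; apply: eq_bigr => i _; ring.
rewrite {}e in h.
have h1 : B ^+ 2 * \sum_(i <- s) a i ^+ 2 <= B ^+ 2 * A ^+ 2.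
  by rewrite ler_wpM2l// sqr_ge0.
have h2 : A ^+ 2 * \sum_(i <- s) b i ^+ 2 <= A ^+ 2 * B ^+ 2.
  by rewrite ler_wpM2l// sqr_ge0.
have : 0 <= 2 * A * B * (A * B - \sum_(i <- s) a i * b i) by nra.
by rewrite pmulr_rge0 ?subr_ge0// !mulr_gt0.
Qed.

(* Greedy choice: |a + S|^2 or |a - S|^2 is at least |a|^2 + |S|^2. *)
Lemma exists_signs (I : eqType) (s : seq I) (f : I -> H) : uniq s ->
  exists eps : I -> R, (forall i, `|eps i| <= 1) /\
  \sum_(i <- s) nrm (f i) ^+ 2 <= nrm (\sum_(i <- s) (eps i)%:C%C *: f i) ^+ 2.
Proof.
elim: s => [_|i s ih /= /andP[iNs us]].
  exists (fun=> 0); split; first by move=> _; rewrite normr0.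
  by rewrite !big_nil nrm0 expr0n.
have [eps [h1 h2]] := ih us.
set S := \sum_(j <- s) (eps j)%:C%C *: f j in h2.
have [e [e1 e2]] : exists e : R, `|e| <= 1 /\
    nrm (f i) ^+ 2 + nrm S ^+ 2 <= nrm (e%:C%C *: f i + S) ^+ 2.
  have [h|/ltW h] := leP 0 (rdot (f i) S); [exists 1 | exists (-1)];
  rewrite ?normrN normr1; split => //; rewrite -!rdotvv;
  rewrite !(rdotDl,rdotDr,rdotZl,rdotZr) (rdotC S); lra.
exists (fun j => if j == i then e else eps j); split.
  by move=> j; case: ifP.
rewrite !big_cons eqxx; apply: le_trans (lerD (lexx _) h2) _.
suff -> : \sum_(j <- s) (if j == i then e else eps j)%:C%C *: f j = S by [].
apply: eq_big_seq => j js.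
by case: eqP => // ji; rewrite -ji js in iNs.
Qed.

(** Complex polarization: expanding at u + w for u = v and for u = i v makes both the sum and the
    difference of <D v, w> and <D w, v> vanish. A real quarter turn shows that complex scalars are
    essential. *)
Lemma dot_quad_eq0 (D : H -> H) : linear D -> (forall v, dot (D v) v = 0) ->
  forall v, D v = 0.
Proof.
move=> lD h v; suff q w : dot (D v) w = 0.
  by apply: rdot_eq0 => w; rewrite /rdot q.
have D_ u u' : D (u + u') = D u + D u' by have := lD 1 u u'; rewrite !scale1r.
have Z_ (a : R[i]) u : D (a *: u) = a *: D u.
  have D0 : D 0 = 0 by apply: (addrI (D 0)); rewrite -D_ !addr0.
  by have := lD a u 0; rewrite !addr0 D0 addr0.
have e1 u : dot (D u) w + dot (D w) u = 0.
  have := h (u + w); rewrite D_ linearDl/= !linearDr/= !h add0r addr0.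
  by [].
have := e1 v; have := e1 ('i *: v).
rewrite Z_ linearZl_LR linearZr_LR/= conjCi => a b.
have b' : dot (D w) v = - dot (D v) w by apply/eqP; rewrite -addr_eq0 addrC b.
move: a; rewrite b' mulrNN -mulr2n => /eqP.
by rewrite mulrn_eq0/= mulf_eq0 (negbTE (neq0Ci _))/= => /eqP.
Qed.

Lemma nrm_opnorm (T : H -> H) (c : R) : linear T -> (opnorm T <= c%:E)%E ->
  forall v, nrm (T v) <= c * nrm v.
Proof.
move=> lT hT v.
have D_ u u' : T (u + u') = T u + T u' by have := lT 1 u u'; rewrite !scale1r.
have T0 : T 0 = 0 by apply: (addrI (T 0)); rewrite -D_ !addr0.
have Z_ (a : R[i]) u : T (a *: u) = a *: T u.
  by have := lT a u 0; rewrite !addr0 T0 addr0.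
have [v0|v0] := eqVneq (nrm v) 0; first by rewrite (nrm_eq0 v0) T0 nrm0 mulr0.
have vp : 0 < nrm v by rewrite lt_neqAle nrm_ge0 eq_sym v0.
have : ((nrm (T ((nrm v)^-1%:C%C *: v)))%:E <= c%:E)%E.
  apply: le_trans hT; apply: ereal_sup_ubound; exists ((nrm v)^-1%:C%C *: v) => //=.
  rewrite nrmE -(rmorph1 (real_complex R)) lecR nrmZ ger0_norm ?invr_ge0 ?nrm_ge0//.
  by rewrite mulVf.
by rewrite lee_fin Z_ nrmZ ger0_norm ?invr_ge0 ?nrm_ge0// mulrC ler_pdivrMr.
Qed.

Lemma opnorm_le (T : H -> H) (c : R) : 0 <= c ->
  (forall v, nrm (T v) <= c * nrm v) -> (opnorm T <= c%:E)%E.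
Proof.
move=> c0 h; apply: ge_ereal_sup => _ [v /= v1 <-]; rewrite lee_fin.
apply: le_trans (h v) _; rewrite -[leRHS]mulr1 ler_wpM2l//.
by rewrite nrmE -(rmorph1 (real_complex R)) lecR in v1.
Qed.

Lemma bounded_operatorP (T : H -> H) : bounded_operator T ->
  exists2 c : R, 0 <= c & forall v, nrm (T v) <= c * nrm v.
Proof.
move=> [lT bT].
have o0 : (0 <= opnorm T)%E.
  apply: le_trans (ereal_sup_ubound _); last first.
    by exists 0 => //=; rewrite normr0 ler01.
  by rewrite lee_fin nrm_ge0.
exists (fine (opnorm T)); first exact: fine_ge0.
by apply: nrm_opnorm => //; rewrite fineK// ge0_fin_numE.
Qed.

End Hilbert.

(** * Functions vanishing at infinity and representations *)

Section ComplexModulus.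
Context {R : realType}.
Implicit Types z w : R[i].

Definition cabs z : R := complex.Re `|z|.

Lemma cabsE z : `|z| = (cabs z)%:C%C.
Proof. by rewrite /cabs RRe_real// normr_real. Qed.

Lemma cabs_ge0 z : 0 <= cabs z.
Proof. by rewrite -ler0c -cabsE. Qed.

Lemma cabsM z w : cabs (z * w) = cabs z * cabs w.
Proof. by apply: complexI; rewrite rmorphM -!cabsE normrM. Qed.

Lemma cabsD z w : cabs (z + w) <= cabs z + cabs w.
Proof. by rewrite -lecR rmorphD -!cabsE ler_normD. Qed.

Lemma cabsB z w : cabs (z - w) = cabs (w - z).
Proof. by apply: complexI; rewrite -!cabsE distrC. Qed.

Lemma cabs_real (x : R) : cabs x%:C%C = `|x|.
Proof. by rewrite /cabs normc_def/= expr0n addr0 sqrtr_sqr. Qed.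

Lemma cabs_conj z : cabs z^* = cabs z.
Proof. by apply: complexI; rewrite -!cabsE norm_conjC. Qed.

Lemma conj_mul_cabs z : z^* * z = (cabs z ^+ 2)%:C%C.
Proof. by rewrite -normCKC cabsE rmorphXn. Qed.

Lemma conjC_real (x : R) : (x%:C%C : R[i])^* = x%:C%C.
Proof. by apply: conj_Creal; apply/complex_realP; exists x. Qed.

Lemma cabs_lt z (e : R[i]) : 0 < e -> (`|z| < e) = (cabs z < complex.Re e).
Proof.
move=> e0; have e1 : e = (complex.Re e)%:C%C by rewrite RRe_real// gtr0_real.
by rewrite {1}e1 cabsE ltcR.
Qed.

End ComplexModulus.

Section CZero.
Context {R : realType} {X : metricType R}.
Implicit Types f g h : X -> R[i].

Lemma ccontP f : continuous (f : X -> R[i]^o) <->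
  forall x (e : R), 0 < e -> \forall y \near x, cabs (f x - f y) < e.
Proof.
split=> fc x.
  move=> e e0; have e1 : 0 < e%:C%C :> R[i] by rewrite ltcR.
  have /cvgrPdist_lt/(_ _ e1) := fc x.
  by apply: filterS => y; rewrite cabs_lt.
apply/cvgrPdist_lt => e e0.
have e1 : e = (complex.Re e)%:C%C by rewrite RRe_real// gtr0_real.
have e2 : 0 < complex.Re e by rewrite -ltcR -e1.
by apply: filterS (fc x _ e2) => y; rewrite cabs_lt.
Qed.

Lemma C0P f : C0 f <-> continuous (f : X -> R[i]^o) /\
  forall e : R, 0 < e -> exists2 K : set X, compact K &
     forall x, ~ K x -> cabs (f x) < e.
Proof.
split=> -[fc f0]; split => // e e0.
  have e1 : 0 < e%:C%C :> R[i] by rewrite ltcR.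
  by have [K cK hK] := f0 _ e1; exists K => // x /hK; rewrite cabs_lt.
have e1 : e = (complex.Re e)%:C%C by rewrite RRe_real// gtr0_real.
have e2 : 0 < complex.Re e by rewrite -ltcR -e1.
by have [K cK hK] := f0 _ e2; exists K => // x /hK; rewrite -cabs_lt.
Qed.

Lemma C0_dom f h : C0 f -> continuous (h : X -> R[i]^o) ->
  (forall x, cabs (h x) <= cabs (f x)) -> C0 h.
Proof.
move=> /C0P[_ f0] hc hf; apply/C0P; split => // e e0.
have [K cK hK] := f0 _ e0; exists K => // x /hK; exact: le_lt_trans.
Qed.

Lemma C0M f g : C0 f -> C0 g -> C0 (fun x => f x * g x).
Proof.
move=> /C0P[fc f0] /C0P[gc g0]; apply/C0P; split => [x|e e0].
  by apply: cvgM; [exact: fc | exact: gc].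
have [K cK hK] := f0 _ e0; have [L cL hL] := g0 _ ltr01.
exists (K `|` L); first exact: compactU.
move=> x /not_orP[/hK h1 /hL h2]; rewrite cabsM.
by have := cabs_ge0 (f x); have := cabs_ge0 (g x); nra.
Qed.

Lemma C0_lin (a : R[i]) f g : C0 f -> C0 g -> C0 (fun x => a * f x + g x).
Proof.
move=> /C0P[fc f0] /C0P[gc g0]; apply/C0P; split => [x|e e0].
  by apply: cvgD; [apply: cvgM; [exact: cvg_cst|exact: fc] | exact: gc].
pose A := cabs a + 1.
have A0 : 0 < A by rewrite /A ltr_wpDl// cabs_ge0.
have e1 : 0 < e / 2 / A by rewrite !divr_gt0.
have e2 : 0 < e / 2 by rewrite divr_gt0.
have [K cK hK] := f0 _ e1; have [L cL hL] := g0 _ e2.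
exists (K `|` L); first exact: compactU.
move=> x /not_orP[/hK h1 /hL h2]; apply: le_lt_trans (cabsD _ _) _.
rewrite cabsM (splitr e) ler_ltD//.
rewrite ltr_pdivlMr// in h1.
have := cabs_ge0 (f x); rewrite /A in h1; lra.
Qed.

Lemma C0_conj f : C0 f -> C0 (fun x => (f x)^*).
Proof.
move=> f0; apply: (C0_dom f0) => [|x]; last by rewrite cabs_conj.
apply/ccontP => x e e0; have /ccontP/(_ x e e0) := f0.1.
by apply: filterS => y; rewrite -rmorphB cabs_conj.
Qed.

Lemma C0_0 : C0 (fun _ : X => 0 : R[i]).
Proof.
apply/C0P; split => [x|e e0]; first exact: cvg_cst.
exists set0; first exact: compact0.
by move=> x _; rewrite -[0]/(0%:C%C) cabs_real normr0.
Qed.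

Lemma continuous_complexify (f : X -> R) :
  continuous f -> continuous (complexify f : X -> R[i]^o).
Proof.
move=> fc; apply/ccontP => x e e0.
have /cvgrPdist_lt/(_ _ e0) := fc x.
by apply: filterS => y; rewrite /complexify -rmorphB cabs_real.
Qed.

Lemma continuous_cabs f : continuous (f : X -> R[i]^o) ->
  continuous (fun x => cabs (f x)).
Proof.
move=> /ccontP fc x; apply/cvgrPdist_lt => e e0.
apply: filterS (fc x _ e0) => y; apply: le_lt_trans.
have h z w : cabs z - cabs w <= cabs (z - w :> R[i]).
  by rewrite lerBlDr; apply: le_trans (cabsD _ _); rewrite subrK.
by rewrite ler_norml h andbT lerNl opprB cabsB h.
Qed.

(* With h := M - sqrt (M^2 - |f|^2) one has (M - h)^2 = M^2 - |f|^2. *)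
Lemma C0_complement f (M : R) : C0 f -> 0 < M -> (forall x, cabs (f x) <= M) ->
  exists2 h : X -> R, C0 (complexify h) &
   forall x, (M - h x) ^+ 2 = M ^+ 2 - cabs (f x) ^+ 2.
Proof.
move=> f0 M0 fM.
have pos x : 0 <= M ^+ 2 - cabs (f x) ^+ 2.
  by rewrite subr_ge0 ler_pXn2r// nnegrE ?cabs_ge0// ltW.
exists (fun x => M - Num.sqrt (M ^+ 2 - cabs (f x) ^+ 2)); last first.
  by move=> x; rewrite opprB addrC subrK sqr_sqrtr.
apply: (C0_dom f0) => [|x].
  apply: continuous_complexify => x.
  apply: cvgB; first exact: cvg_cst.
  apply: (@continuous_comp _ _ _ (fun x => M ^+ 2 - cabs (f x) ^+ 2) Num.sqrt).
    apply: cvgB; first exact: cvg_cst.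
    rewrite /=; under eq_cvg do rewrite expr2; rewrite expr2.
    by apply: cvgM; apply: continuous_cabs; exact: f0.1.
  exact: sqrt_continuous.
rewrite /complexify cabs_real.
set s := Num.sqrt _.
have s0 : 0 <= s by exact: sqrtr_ge0.
have s2 : s ^+ 2 = M ^+ 2 - cabs (f x) ^+ 2 by rewrite sqr_sqrtr.
have c0 := cabs_ge0 (f x); have := fM x => cM.
rewrite ler_norml; apply/andP; split; first nra.
rewrite lerBlDr -lerBlDl; nra.
Qed.

End CZero.

Section Rep.
Context {R : realType} {X : metricType R} {H : completeNormedModType R[i]}.
Variables (dot : {dot H for @conjC R[i]}) (pi : (X -> R[i]) -> H -> H).
Hypothesis hdot : induces_norm dot.
Hypothesis rep : representation dot pi.
Implicit Types f g : X -> R[i].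
Implicit Types v w : H.

Lemma pi_linear f : C0 f -> linear (pi f).
Proof. by move=> /(rep_bounded rep)[]. Qed.

Lemma pi_real_sym (h : X -> R) v w : C0 (complexify h) ->
  rdot dot (pi (complexify h) v) w = rdot dot v (pi (complexify h) w).
Proof.
move=> h0; rewrite /rdot -(rep_star rep h0).
suff -> : (fun x => (complexify h x)^*) = complexify h by [].
by apply/funext => x; rewrite /complexify conjC_real.
Qed.

Lemma nrm_pi_sq f v : C0 f ->
  nrm (pi f v) ^+ 2 = rdot dot (pi (complexify (fun x => cabs (f x) ^+ 2)) v) v.
Proof.
move=> f0; rewrite -(rdotvv hdot) /rdot -(rep_star rep f0) -(rep_mul rep (C0_conj f0) f0).
suff -> : (fun x => (f x)^* * f x) = complexify (fun x => cabs (f x) ^+ 2) by [].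
by apply/funext => x; rewrite conj_mul_cabs.
Qed.

Lemma pi_fun0 v : pi (fun _ => 0) v = 0.
Proof.
have := rep_linear rep (-1) C0_0 C0_0 v.
suff -> : (fun x : X => -1 * 0 + 0) = (fun=> 0 : R[i]).
  by rewrite scaleN1r addNr.
by apply/funext => x; rewrite mulr0 addr0.
Qed.

(** The bound M is raised to the positive N = M + e / |v|, so that N^2 - |f|^2 is a square (N - h)^2
    with h real in C_0. The constant N acts as a multiple of the identity of H, which keeps every
    function fed to [pi] inside C_0. *)
Lemma nrm_pi_le f (M : R) v : C0 f -> 0 <= M -> (forall x, cabs (f x) <= M) ->
  nrm (pi f v) <= M * nrm v.
Proof.
move=> f0 M0 fM; apply/ler_addgt0Pr => e e0.
have [v0|v0] := eqVneq (nrm v) 0.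
  have [c c0 hc] := bounded_operatorP (rep_bounded rep f0).
  by have := hc v; rewrite v0 !mulr0; lra.
have vp : 0 < nrm v by rewrite lt_neqAle nrm_ge0 eq_sym v0.
pose N := M + e / nrm v.
have -> : M * nrm v + e = N * nrm v by rewrite mulrDl mulfVK.
have N0 : 0 < N by rewrite /N ltr_wpDl// divr_gt0.
have fN x : cabs (f x) <= N by rewrite (le_trans (fM x))// lerDl ltW// divr_gt0.
have [h h0 hh] := C0_complement f0 N0 fN.
have hh0 := C0M h0 h0.
have : 0 <= nrm (N%:C%C *: v - pi (complexify h) v) ^+ 2 by rewrite sqr_ge0.
have -> : nrm (N%:C%C *: v - pi (complexify h) v) ^+ 2 = N ^+ 2 * nrm v ^+ 2
    - 2 * N * rdot dot (pi (complexify h) v) v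
    + rdot dot (pi (fun x => complexify h x * complexify h x) v) v.
  rewrite (rep_mul rep h0 h0) (pi_real_sym (pi (complexify h) v) _ h0) -!(rdotvv hdot).
  rewrite !(rdotBl,rdotBr,rdotZl,rdotZr) (rdotC _ v (pi _ v)); ring.
move=> hpos.
(* N^2 |v|^2 - |pi f v|^2 = |(N - pi h) v|^2 *)
have e1 : nrm (pi f v) ^+ 2 = 2 * N * rdot dot (pi (complexify h) v) v -
    rdot dot (pi (fun x => complexify h x * complexify h x) v) v.
  rewrite nrm_pi_sq//.
  have -> : complexify (fun x => cabs (f x) ^+ 2) =
     (fun x => (-1)%:C%C * (complexify h x * complexify h x) +
         ((2 * N)%:C%C * complexify h x + 0)).
    apply/funext => x; rewrite /complexify addr0 -!rmorphM -rmorphD; congr (_ %:C)%C.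
    by have := hh x => hx; lra.
  rewrite (rep_linear rep _ hh0 (C0_lin _ h0 C0_0)).
  rewrite (rep_linear rep _ h0 C0_0) pi_fun0 addr0 rdotDl !rdotZl.
  ring.
have : nrm (pi f v) ^+ 2 <= (N * nrm v) ^+ 2.
  rewrite exprMn e1 -subr_ge0. by rewrite opprB addrA addrAC.
by rewrite ler_pXn2r// nnegrE ?nrm_ge0// mulr_ge0 ?nrm_ge0// ltW.
Qed.

End Rep.

(** * Integrals of the identity against finite measures on the line *)

Section BarycenterOnR.
Context {R : realType}.
Implicit Types mu : {measure set R -> \bar R}.

Lemma integrable_id_bounded_support mu (M : R) : (mu setT < +oo)%E ->
  mu (~` `[- M, M]%classic) = 0%E -> mu.-integrable setT (EFin \o id).
Proof.
move=> fin0 supp.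
have mI : measurable (~` `[- M, M]%classic : set R) by apply: measurableC.
apply/(negligible_integrable mI) => //.
  by apply/measurable_EFinP; exact: measurable_id.
rewrite setTD setCK; apply: measurable_bounded_integrable => //.
  by apply: le_lt_trans fin0; apply: le_measure; rewrite ?inE.
exists `|M|; split; first exact: num_real.
move=> y My t /=; rewrite in_itv/= => /andP[h1 h2].
apply: le_trans (ltW My); apply: le_trans (ler_norm M).
by rewrite ler_norml h1.
Qed.

Lemma Rintegral_measure_add mu mu1 mu2 :
  (forall B, measurable B -> mu B = (mu1 B + mu2 B)%E) ->
  mu1.-integrable setT (EFin \o id) -> mu2.-integrable setT (EFin \o id) ->
  \int[mu]_t t = \int[mu1]_t t + \int[mu2]_t t.
Proof.
move=> h i1 i2; rewrite /Rintegral -fineD; last 2 first.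
- exact: (integrable_fin_num measurableT i1).
- exact: (integrable_fin_num measurableT i2).
congr fine.
rewrite (@eq_measure_integral _ _ _ _ (measure_add mu1 mu2)); last first.
  by move=> B mB _; rewrite h//; exact/esym/measure_addE.
by apply: (integral_measure_add measurableT i1 i2); apply/measurable_EFinP.
Qed.

Lemma Rintegral_id_ge mu (D : set R) (s : R) : measurable D ->
  (mu setT < +oo)%E -> mu (~` D) = 0%E -> (forall t, D t -> s <= t) ->
  mu.-integrable setT (EFin \o id) ->
  s * fine (mu setT) <= \int[mu]_t t.
Proof.
move=> mD fin0 supp hs i1.
have mC : measurable (~` D) by exact: measurableC.
have ics : mu.-integrable setT (EFin \o (fun=> s)).
  apply: measurable_bounded_integrable => //.
  by exists `|s|; split; [exact: num_real|move=> y My t _; exact: ltW].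
rewrite -Rintegral_cst// /Rintegral.
rewrite (negligible_integral mC _ ics supp)// (negligible_integral mC _ i1 supp)//.
rewrite setTD setCK; apply: le_Rintegral => //.
  exact: (integrableS _ _ _ ics).
exact: (integrableS _ _ _ i1).
Qed.

Lemma Rintegral_id_le mu (D : set R) (s : R) : measurable D ->
  (mu setT < +oo)%E -> mu (~` D) = 0%E -> (forall t, D t -> t <= s) ->
  mu.-integrable setT (EFin \o id) ->
  \int[mu]_t t <= s * fine (mu setT).
Proof.
move=> mD fin0 supp hs i1.
have mC : measurable (~` D) by exact: measurableC.
have ics : mu.-integrable setT (EFin \o (fun=> s)).
  apply: measurable_bounded_integrable => //.
  by exists `|s|; split; [exact: num_real|move=> y My t _; exact: ltW].
rewrite -Rintegral_cst// /Rintegral.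
rewrite (negligible_integral mC _ ics supp)// (negligible_integral mC _ i1 supp)//.
rewrite setTD setCK; apply: le_Rintegral => //.
  exact: (integrableS _ _ _ i1).
exact: (integrableS _ _ _ ics).
Qed.

End BarycenterOnR.

(** * Spectral projections *)

Section Spectral.
Context {R : realType} {H : completeNormedModType R[i]}.
Variable dot : {dot H for @conjC R[i]}.
Hypothesis hdot : induces_norm dot.
Local Notation rdot := (rdot dot).

Lemma linD (T : H -> H) : linear T -> forall u v, T (u + v) = T u + T v.
Proof. by move=> l u v; have := l 1 u v; rewrite !scale1r. Qed.

Lemma lin0 (T : H -> H) : linear T -> T 0 = 0.
Proof. by move=> l; apply: (addrI (T 0)); rewrite -linD// !addr0. Qed.

Lemma linZ (T : H -> H) : linear T -> forall a v, T (a *: v) = a *: T v.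
Proof. by move=> l a v; have := l a v 0; rewrite !addr0 lin0// addr0. Qed.

Lemma linN (T : H -> H) : linear T -> forall v, T (- v) = - T v.
Proof. by move=> l v; rewrite -scaleN1r linZ// scaleN1r. Qed.

Lemma linB (T : H -> H) : linear T -> forall u v, T (u - v) = T u - T v.
Proof. by move=> l u v; rewrite linD// linN. Qed.

Section OrthogonalProjection.
Variable P : H -> H.
Hypothesis hP : orthogonal_projection dot P.

Lemma proj_linear : linear P. Proof. by case: hP => -[]. Qed.

Lemma proj_id v : P (P v) = P v. Proof. by case: hP. Qed.

Lemma proj_sym v w : rdot (P v) w = rdot v (P w).
Proof. by rewrite /rdot; case: hP => _ _ ->. Qed.

Lemma proj_nrm v : rdot (P v) v = nrm (P v) ^+ 2.
Proof. by rewrite -(rdotvv hdot) [RHS]proj_sym proj_id proj_sym. Qed.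

Lemma proj_contract v : nrm (P v) <= nrm v.
Proof.
have := rdot_le hdot (P v) v; rewrite proj_nrm expr2.
have [->|p0] := eqVneq (nrm (P v)) 0; first by rewrite nrm_ge0.
by rewrite ler_pM2l// lt_neqAle nrm_ge0 eq_sym p0.
Qed.

End OrthogonalProjection.

Variables (A : H -> H) (E : set R -> H -> H).
Hypothesis linA : linear A.
Hypothesis symA : forall v w, rdot (A v) w = rdot v (A w).
Hypothesis res : spectral_resolution dot A E.

Let pvm : projection_valued_measure dot E := resolution_pvm res.
Let projE B (mB : measurable B) := pvm_projection pvm mB.

(** The bounded support given by [resolution_bounded] is what makes t integrable against mu. *)
Lemma spectral_measure_ex v : exists mu : {measure set R -> \bar R},
  [/\ forall B, measurable B -> mu B = (rdot (E B v) v)%:E,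
      mu.-integrable setT (EFin \o id) & rdot (A v) v = \int[mu]_t t].
Proof.
have [mu hmu] := pvm_sigma_additive pvm v.
have hmu' B : measurable B -> mu B = (rdot (E B v) v)%:E by move=> mB; rewrite hmu.
exists mu; split => //; last by rewrite /rdot (resolution_integral res hmu).
have [M hM] := resolution_bounded res.
apply: (@integrable_id_bounded_support _ _ M); first by rewrite hmu'// ltry.
by rewrite hmu' ?hM ?rdot0l//; apply: measurableC.
Qed.

Lemma spectral_set0 v : E set0 v = 0.
Proof.
have [mu [hmu _ _]] := spectral_measure_ex v.
apply: nrm_eq0; apply/eqP; rewrite -sqrf_eq0 -(proj_nrm (projE measurable0)).
by have := hmu set0 measurable0; rewrite measure0 => -[<-].
Qed.

(* The scalar measures of the two components of a vector add up, so the
   quadratic form of A has no cross term between them. *)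
Lemma spectral_cross p q : (forall D, measurable D -> rdot (E D p) q = 0) ->
  rdot (A p) q = 0.
Proof.
move=> cross.
have [mu [hmu imu Amu]] := spectral_measure_ex (p + q).
have [mu1 [hmu1 imu1 Amu1]] := spectral_measure_ex p.
have [mu2 [hmu2 imu2 Amu2]] := spectral_measure_ex q.
have : rdot (A (p + q)) (p + q) = rdot (A p) p + rdot (A q) q.
  rewrite Amu Amu1 Amu2; apply: Rintegral_measure_add => // D mD.
  rewrite hmu// hmu1// hmu2// -EFinD; congr EFin.
  have PD := projE mD.
  rewrite (linD (proj_linear PD)) !(rdotDl,rdotDr) cross//.
  by rewrite (proj_sym PD q) (rdotC _ q) cross// addr0 add0r.
rewrite (linD linA) !(rdotDl,rdotDr) (symA q) (rdotC _ q (A p)); lra.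
Qed.

(** The two vectors lie in complementary ranges, and every E D preserves this orthogonality because
    it commutes with E B; [spectral_cross] then applies. *)
Lemma spectral_orthogonal B x y : measurable B ->
  rdot (A (E B x)) (y - E B y) = 0.
Proof.
move=> mB; have PB := projE mB; apply: spectral_cross => D mD.
rewrite -(pvm_setI pvm mD mB) setIC (pvm_setI pvm mB mD) (proj_sym PB).
by rewrite (linB (proj_linear PB)) (proj_id PB) subrr rdotC rdot0l.
Qed.

(** A preserves the range of E B by [spectral_orthogonal], and by symmetry also the orthogonal
    complement; x is split along the two. *)
Lemma spectral_commute B x : measurable B -> E B (A x) = A (E B x).
Proof.
move=> mB; have PB := projE mB; have lE := proj_linear PB.
have a1 z : A (E B z) = E B (A (E B z)).
  apply/eqP; rewrite -subr_eq0; apply/eqP; apply: (rdot_eq0 hdot) => w.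
  rewrite rdotBl (proj_sym PB) -rdotBr; exact: spectral_orthogonal.
have a2 : E B (A (x - E B x)) = 0.
  apply: (rdot_eq0 hdot) => w.
  by rewrite (proj_sym PB) symA rdotC spectral_orthogonal.
by rewrite a1 -{1}(subrK (E B x) x) (linD linA) (linD lE) a2 add0r.
Qed.

Lemma spectral_measure_range B x : measurable B ->
  exists mu : {measure set R -> \bar R},
  [/\ (mu setT < +oo)%E, fine (mu setT) = nrm (E B x) ^+ 2, mu (~` B) = 0%E,
      mu.-integrable setT (EFin \o id) &
      rdot (A (E B x)) (E B x) = \int[mu]_t t].
Proof.
move=> mB; have [mu [hmu imu Amu]] := spectral_measure_ex (E B x).
have mC : measurable (~` B) by apply: measurableC.
exists mu; split => //.
- by rewrite hmu// ltry.
- by rewrite hmu//= (pvm_setT pvm) (rdotvv hdot).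
- by rewrite hmu// -(pvm_setI pvm mC mB) setICl spectral_set0 rdot0l.
Qed.

Lemma spectral_ge (B : set R) x (s : R) : measurable B -> (forall t, B t -> s <= t) ->
  s * nrm (E B x) ^+ 2 <= rdot (A (E B x)) (E B x).
Proof.
move=> mB hs; have [mu [fmu <- sB imu ->]] := spectral_measure_range x mB.
exact: (Rintegral_id_ge mB).
Qed.

Lemma spectral_le (B : set R) x (s : R) : measurable B -> (forall t, B t -> t <= s) ->
  rdot (A (E B x)) (E B x) <= s * nrm (E B x) ^+ 2.
Proof.
move=> mB hs; have [mu [fmu <- sB imu ->]] := spectral_measure_range x mB.
exact: (Rintegral_id_le mB).
Qed.

End Spectral.

Lemma le_geometric0 (R : realType) (a q c : R) : 0 <= q -> q < 1 ->
  (forall k, a <= q ^+ k * c) -> a <= 0.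
Proof.
move=> q0 q1 h.
have : (fun k => q ^+ k * c) @ \oo --> 0 * c.
  by apply: cvgMl; apply: cvg_expr; rewrite ger0_norm.
rewrite mul0r => hc; rewrite -(cvg_lim _ hc)//; apply: limr_ge; first exact: (cvgP _ hc).
by near=> k; exact: h.
Unshelve. all: by end_near. Qed.

Section Vanishing.
Context {R : realType} {X : metricType R} {H : completeNormedModType R[i]}.
Variables (dot : {dot H for @conjC R[i]}) (pi : (X -> R[i]) -> H -> H).
Hypothesis hdot : induces_norm dot.
Hypothesis rep : representation dot pi.

(* On the range of P the powers of B grow at least like s^k, on the range of
   pi psi at most like r^k. *)
Lemma proj_vanish (P B : H -> H) (psi : X -> R[i]) (h : X -> R) (r s M : R) :
  C0 psi -> 0 <= M -> (forall x, cabs (psi x) <= M) ->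
  (forall f, C0 f -> C0 (fun x => (h x)%:C%C * f x) /\
     forall v, B (pi f v) = pi (fun x => (h x)%:C%C * f x) v) ->
  0 <= r -> r < s -> (forall x, psi x != 0 -> `|h x| <= r) ->
  orthogonal_projection dot P -> (forall v, P (B v) = B (P v)) ->
  (forall v, s * nrm (P v) ^+ 2 <= rdot dot (B (P v)) (P v)) ->
  forall v, P (pi psi v) = 0.
Proof.
move=> psi0 M0 psiM hB r0 rs hr hP PB Bs v.
have s0 : 0 < s by exact: le_lt_trans rs.
(* Cauchy-Schwarz turns the lower bound on the quadratic form into one on norms, in a form that can
   be iterated since P commutes with B. *)
have step u : s * nrm (P u) <= nrm (P (B u)).
  have := le_trans (Bs u) (rdot_le hdot _ _); rewrite PB expr2 mulrA.
  have [->|p0] := eqVneq (nrm (P u)) 0; first by rewrite !mulr0 nrm_ge0.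
  by rewrite ler_pM2r// lt_neqAle nrm_ge0 eq_sym p0.
have lower k u : s ^+ k * nrm (P u) <= nrm (P (iter k B u)).
  elim: k => [|k ih]; first by rewrite mul1r.
  rewrite iterS exprS -mulrA; apply: le_trans (step _).
  by rewrite ler_wpM2l// ltW.
have upper k : C0 (fun x => ((h x) ^+ k)%:C%C * psi x) /\
    iter k B (pi psi v) = pi (fun x => ((h x) ^+ k)%:C%C * psi x) v.
  elim: k => [|k [ih1 ih2]].
    suff -> : (fun x => ((h x) ^+ 0)%:C%C * psi x) = psi by [].
    by apply/funext => x; rewrite expr0 mul1r.
  have [e1 e2] := hB _ ih1.
  suff e : (fun x => ((h x) ^+ k.+1)%:C%C * psi x) =
      (fun x => (h x)%:C%C * (((h x) ^+ k)%:C%C * psi x)).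
    by rewrite e iterS ih2 e2.
  by apply/funext => x; rewrite mulrA -rmorphM exprS.
have key k : s ^+ k * nrm (P (pi psi v)) <= r ^+ k * (M * nrm v).
  apply: le_trans (lower k _) _; apply: le_trans (proj_contract hdot hP _) _.
  have [c0 ->] := upper k; rewrite mulrA.
  apply: (nrm_pi_le hdot rep) => // [|x]; first by rewrite mulr_ge0// exprn_ge0.
  rewrite cabsM cabs_real normrX.
  have [->|px] := eqVneq (psi x) 0.
    by rewrite -[0 : R[i]]/(0%:C%C) cabs_real normr0 mulr0 mulr_ge0// exprn_ge0.
  by rewrite ler_pM ?exprn_ge0 ?cabs_ge0// lerXn2r ?nnegrE ?hr.
apply: nrm_eq0; apply/eqP; rewrite eq_le nrm_ge0 andbT.
(* Dividing [key] by s^k bounds the norm by (r / s)^k M |v| for every k. *)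
apply: (@le_geometric0 _ _ (r / s) (M * nrm v)).
- by rewrite divr_ge0// ltW.
- by rewrite ltr_pdivrMr// mul1r.
- move=> k; rewrite expr_div_n mulrAC ler_pdivlMr ?exprn_gt0// mulrC.
  exact: key.
Qed.

End Vanishing.

(** * Cut-off functions *)

Section FiniteSums.
Context {R : realType} {I : eqType}.
Implicit Types s t : seq I.

Lemma big_subset_filter (V : zmodType) s t (f : I -> V) : uniq s -> uniq t ->
  {subset s <= t} -> \sum_(i <- t | i \in s) f i = \sum_(i <- s) f i.
Proof.
move=> us ut st; rewrite -big_filter; apply: perm_big; apply: uniq_perm => //.
  exact: filter_uniq.
by move=> i; rewrite mem_filter; case: (boolP (i \in s)) => //= /st.
Qed.

Lemma big_subset_supp (V : zmodType) s t (f : I -> V) : uniq s -> uniq t ->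
  {subset s <= t} -> (forall i, i \in t -> f i != 0 -> i \in s) ->
  \sum_(i <- t) f i = \sum_(i <- s) f i.
Proof.
move=> us ut st h; rewrite -(big_subset_filter f us ut st) [RHS]big_mkcond/=.
apply: eq_big_seq => i it; case: ifPn => // iNs; apply/eqP.
by apply: contraNT iNs; exact: h.
Qed.

Lemma ler_sum_subset s t (f : I -> R) : uniq s -> uniq t ->
  {subset s <= t} -> (forall i, 0 <= f i) ->
  \sum_(i <- s) f i <= \sum_(i <- t) f i.
Proof.
move=> us ut st f0; rewrite -(big_subset_filter f us ut st) big_mkcond/=.
by apply: ler_sum => i _; case: ifP.
Qed.

Lemma big_diff (V : zmodType) s t (f : I -> V) : uniq s -> uniq t ->
  {subset s <= t} ->
  \sum_(i <- t) f i - \sum_(i <- s) f i = \sum_(i <- t | i \notin s) f i.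
Proof.
move=> us ut st; rewrite (bigID (fun i => i \in s))/=.
by rewrite (big_subset_filter f us ut st) addrAC subrr add0r.
Qed.

Lemma sum_indicator s (P : pred I) :
  \sum_(i <- s) (P i)%:R = (count P s)%:R :> R.
Proof.
elim: s => [|i s ih]; first by rewrite big_nil.
by rewrite big_cons ih/= natrD.
Qed.

End FiniteSums.

Section Cutoff.
Context {R : realType} {X : metricType R}.
Implicit Types (B : set X) (x y : X).

Lemma lipschitz_continuous (f : X -> R) (L : R) :
  (forall x y, `|f x - f y| <= L * mdist x y) -> continuous f.
Proof.
move=> h x; apply/cvgrPdist_lt => e e0.
have L0 : 0 < `|L| + 1 by rewrite ltr_wpDl.
have d0 : 0 < e / (`|L| + 1) by rewrite divr_gt0.
near=> y.
have : ball x (e / (`|L| + 1)) y by near: y; exact: nbhsx_ballx.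
rewrite ballEmdist/= ltr_pdivlMr// => hy.
apply: le_lt_trans (h x y) _; apply: le_lt_trans hy.
have := mdist_ge0 x y; have := ler_norm L; nra.
Unshelve. all: by end_near. Qed.

Lemma compact_mdist_bounded (K : set X) (x0 : X) : compact K ->
  exists M : R, forall x, K x -> mdist x0 x <= M.
Proof.
move=> cK.
have dc : continuous (fun x => mdist x0 x).
  apply: (@lipschitz_continuous _ 1) => x y; rewrite mul1r ler_norml.
  have := metric_triangle x0 y x; have := metric_triangle x0 x y.
  rewrite (metric_sym y x) => ? ?; apply/andP; split; lra.
have := continuous_compact (continuous_subspaceT dc) cK.
move=> /compact_bounded[M [_ hM]]; exists (M + 1) => x Kx.
have := hM (M + 1); rewrite ltrDl ltr01 => /(_ isT _ (imageP _ Kx)).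
exact: le_trans (ler_norm _).
Qed.

(* dset set0 x = 0. *)
Definition dset B x : R := inf [set mdist x b | b in B].

Lemma dset_le B x b : B b -> dset B x <= mdist x b.
Proof.
move=> Bb; apply: ge_inf; last by exists b.
by exists 0 => _ [y _ <-]; exact: mdist_ge0.
Qed.

Lemma dset_ge0 B x : B !=set0 -> 0 <= dset B x.
Proof.
move=> [b Bb]; apply: lb_le_inf; first by exists (mdist x b); exists b.
by move=> _ [y _ <-]; exact: mdist_ge0.
Qed.

Lemma dset_lt B x (t : R) : B !=set0 -> dset B x < t ->
  exists2 b, B b & mdist x b < t.
Proof.
move=> [b Bb] h; have [|_ [y By <-] yt] := inf_lt _ h; last by exists y.
by exists (mdist x b); exists b.
Qed.

Lemma dset_lip B x y : B !=set0 -> dset B x <= mdist x y + dset B y.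
Proof.
move=> [b Bb]; rewrite -lerBlDl; apply: lb_le_inf.
  by exists (mdist y b); exists b.
move=> _ [z Bz <-]; rewrite lerBlDl.
exact: le_trans (dset_le _ Bz) (metric_triangle _ _ _).
Qed.

(** A plateau of height 1 up to distance (kappa - 1) rho from B, then a linear descent to 0 at
    distance kappa rho. The value kappa = 1 serves the partition of unity, kappa = 2 the cut-offs
    that equal 1 on its supports. *)
Definition tent (rho kappa : R) B x : R :=
  Num.min 1 (Num.max 0 (kappa - dset B x / rho)).

Section Tent.
Variables (rho : R) (rho0 : 0 < rho).

Lemma tent_ge0 kappa B x : 0 <= tent rho kappa B x.
Proof. by rewrite /tent le_min ler01 le_max lexx. Qed.

Lemma tent_le1 kappa B x : tent rho kappa B x <= 1.
Proof. by rewrite /tent ge_min lexx. Qed.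

Lemma tent_lip kappa B x y : B !=set0 ->
  `|tent rho kappa B x - tent rho kappa B y| <= rho^-1 * mdist x y.
Proof.
move=> B0.
have h u v : tent rho kappa B u <= tent rho kappa B v + rho^-1 * mdist u v.
  have d0 : 0 <= rho^-1 * mdist u v by rewrite mulr_ge0 ?mdist_ge0// invr_ge0 ltW.
  have dl : dset B v / rho <= rho^-1 * mdist u v + dset B u / rho.
    have := dset_lip v u B0; rewrite (metric_sym v u) => h.
    by rewrite [rho^-1 * _]mulrC -mulrDl ler_pM2r ?invr_gt0.
  rewrite /tent /Num.min /Num.max; case: ifP; case: ifP; case: ifP; case: ifP;
  move=> *; lra.
by rewrite ler_norml lerBlDl h andbT lerBrDl addrC -lerBrDl opprK metric_sym h.
Qed.

Lemma tent_neq0 kappa B x : B !=set0 -> tent rho kappa B x != 0 ->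
  exists2 b, B b & mdist x b < kappa * rho.
Proof.
move=> B0 h; apply: dset_lt => //; rewrite -ltr_pdivrMr//.
by rewrite ltNge; apply: contraNN h => h; rewrite /tent max_l ?subr_le0// min_r ?ler01.
Qed.

Lemma tent_eq1 B b : B b -> tent rho 1 B b = 1.
Proof.
move=> Bb; have d0 : dset B b = 0.
  apply/eqP; rewrite eq_le dset_ge0 ?andbT; last by exists b.
  by rewrite -(mdistxx b) dset_le.
by rewrite /tent d0 mul0r subr0 max_r ?ler01// minxx.
Qed.

Lemma tent1_tent2 B x : tent rho 1 B x != 0 -> tent rho 2 B x = 1.
Proof.
rewrite /tent; have [h|h] := leP (1 - dset B x / rho) 0.
  by rewrite min_r ?eqxx ?ler01.
by move=> _; rewrite max_r; first rewrite min_l//; lra.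
Qed.

End Tent.

End Cutoff.

(* F is an increasing exhaustion of the index set by finite sets. *)
Record cutoff_system {R : realType} {X : metricType R} {I : eqType}
    (F : nat -> seq I) (p q : I -> X -> R) (N L D : R) : Prop := {
  cutoff_uniq : forall k, uniq (F k) ;
  cutoff_mono : forall k l, (k <= l)%N -> {subset F k <= F l} ;
  cutoff_C0p : forall k i, i \in F k -> C0 (complexify (p i)) ;
  cutoff_C0q : forall k i, i \in F k -> C0 (complexify (q i)) ;
  cutoff_p_ge0 : forall i x, 0 <= p i x ;
  cutoff_q_ge0 : forall i x, 0 <= q i x ;
  cutoff_q_le1 : forall i x, q i x <= 1 ;
  cutoff_pq : forall i x, p i x * q i x = p i x ;
  cutoff_sum_p : forall k x, \sum_(i <- F k) p i x <= 1 ;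
  cutoff_exhaust : forall K : set X, compact K -> exists k0, forall k x,
    (k0 <= k)%N -> K x -> \sum_(i <- F k) p i x = 1 ;
  cutoff_sum_q : forall k x, \sum_(i <- F k) q i x <= N ;
  cutoff_lip : forall k (eps : I -> R) x y, (forall i, `|eps i| <= 1) ->
    `|\sum_(i <- F k) eps i * q i x - \sum_(i <- F k) eps i * q i y|
      <= L * mdist x y ;
  cutoff_diam : forall k i x y, i \in F k -> q i x != 0 -> q i y != 0 ->
    mdist x y <= D
}.

(** * Finite exhaustion of the cover and the partition of unity *)

Section CutoffExistence.
Context {R : realType} {X : metricType R}.
Hypothesis hproper : proper_metric X.
Variables (U : set (set X)) (n : nat) (r diam : R) (x0 : X).
Hypothesis r0 : 0 < r.
Hypothesis covU : \bigcup_(B in U) B = setT.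
Hypothesis diamU : forall B, U B -> forall x y, B x -> B y -> mdist x y <= diam.
Hypothesis multU : forall x : X,
  ([set B | U B /\ B `&` ball x r !=set0] #<= `I_n.+1)%card.

Let meets x (t : R) : set (set X) := [set B | U B /\ B `&` ball x t !=set0].

(** The closed ball of radius t is compact, and near each of its points only the at most n+1 members
    meeting a ball of radius r occur. The filter [G] of eventual inclusion of finite families turns
    this local finiteness into one finite family valid on the whole ball. *)
Lemma meets_finite x (t : R) : finite_set (meets x t).
Proof.
(* compact_cover requires a pointed space, hence near_covering. *)
pose G := filter_from [set s : set (set X) | finite_set s]
  (fun s => [set s' | s `<=` s']).
have FG : Filter G.
  apply: filter_from_filter; first by exists set0; exact: finite_set0.
  move=> s1 s2 f1 f2; exists (s1 `|` s2); first by rewrite /= finite_setU.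
  by move=> s h; split => B hB; apply: h; [left|right].
have /compact_near_coveringP cK := @hproper x t.
have [|s fs hs] :=
  cK _ G (fun s y => forall B, U B -> B y -> s B) FG; last first.
  apply: sub_finite_set fs => B [UB [b [Bb]]]; rewrite ballEmdist/= => /ltW xb.
  by apply: (hs s) Bb.
move=> y _; exists (ball y r, [set s' | meets y r `<=` s']).
  split; first exact: nbhsx_ballx.
  by exists (meets y r) => //; apply: card_le_finite (multU y) _; exact: finite_II.
by move=> [z s'] /= [yz hs'] B UB Bz; apply: hs'; split => //; exists z.
Qed.

(** The k-th stage of the exhaustion. Meeting a ball also discards the empty set, whose tents would
    be constantly 1 because [dset] is 0 there. *)
Definition meet_seq (k : nat) : seq (set X) := enum_fset (fset_set (meets x0 k%:R)).

Lemma mem_meet_seq k B : (B \in meet_seq k) <-> meets x0 k%:R B.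
Proof.
rewrite /meet_seq.
have -> : (B \in enum_fset (fset_set (meets x0 k%:R))) = (B \in meets x0 k%:R).
  exact: (in_fset_set (meets_finite _ _)).
by split=> [/set_mem|/mem_set].
Qed.

Lemma meet_seq_uniq k : uniq (meet_seq k).
Proof. exact: fset_uniq. Qed.

Lemma meet_seq_mono k l : (k <= l)%N -> {subset meet_seq k <= meet_seq l}.
Proof.
move=> kl B /mem_meet_seq[UB [b [Bb hb]]]; apply/mem_meet_seq; split => //.
exists b; split => //; move: hb; rewrite !ballEmdist/= => hb.
by apply: lt_le_trans hb _; rewrite ler_nat.
Qed.

Lemma meet_seq_U k B : B \in meet_seq k -> U B /\ B !=set0.
Proof. by move=> /mem_meet_seq[UB [b [Bb _]]]; split => //; exists b. Qed.

(** At half the scale, the tents of reach rho and 2 rho both vanish at distance r from B, so the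
    multiplicity bound for balls of radius r applies to both families. *)
Let rho := r / 2.
Let rho0 : 0 < rho. Proof. by rewrite divr_gt0. Qed.

Lemma tent_meets kappa B x : kappa <= 2 -> U B -> B !=set0 ->
  tent rho kappa B x != 0 -> meets x r B.
Proof.
move=> k2 UB B0 h; split => //.
have [b Bb hb] := tent_neq0 rho0 B0 h.
exists b; split => //; rewrite ballEmdist/=; apply: lt_le_trans hb _.
by rewrite /rho mulrA ler_pdivrMr// mulrC ler_pM2l.
Qed.

Lemma count_meets (s : seq (set X)) x (P : pred (set X)) : uniq s ->
  (forall B, B \in s -> P B -> meets x r B) -> (count P s <= n.+1)%N.
Proof.
move=> us h; rewrite -size_filter.
apply: leq_trans (geq_card_fset_set (multU x)).
apply: uniq_leq_size; first exact: filter_uniq.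
move=> B; rewrite mem_filter => /andP[PB Bs].
have -> : (B \in enum_fset (fset_set (meets x r))) = (B \in meets x r).
  exact: (in_fset_set (meets_finite _ _)).
by apply: mem_set; exact: h.
Qed.

Lemma tent_count kappa k x : kappa <= 2 ->
  (count (fun B => tent rho kappa B x != 0%R) (meet_seq k) <= n.+1)%N.
Proof.
move=> k2; apply: (@count_meets _ x) (meet_seq_uniq k) _ => B /meet_seq_U[UB B0].
exact: tent_meets.
Qed.

Lemma tent_sum_le kappa k x : kappa <= 2 ->
  \sum_(B <- meet_seq k) tent rho kappa B x <= n.+1%:R.
Proof.
move=> k2; apply: (@le_trans _ _ (\sum_(B <- meet_seq k) (tent rho kappa B x != 0)%:R)).
  apply: ler_sum => B _; case: eqVneq => [->//|_]; exact: tent_le1.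
by rewrite sum_indicator ler_nat tent_count.
Qed.

(** A term contributes only if its tent is nonzero at x or at y, which leaves at most n+1 members
    for each point, and each tent is Lipschitz with constant 1 / rho. The bound is uniform in the
    stage and in the coefficients. *)
Lemma tent_sum_lip kappa k (eps : set X -> R) x y : kappa <= 2 ->
  (forall B, `|eps B| <= 1) ->
  `|\sum_(B <- meet_seq k) eps B * tent rho kappa B x -
    \sum_(B <- meet_seq k) eps B * tent rho kappa B y|
  <= 2 * n.+1%:R / rho * mdist x y.
Proof.
move=> k2 heps; rewrite -sumrB; apply: le_trans (ler_norm_sum _ _ _) _.
have d0 : 0 <= rho^-1 * mdist x y by rewrite mulr_ge0 ?mdist_ge0// invr_ge0 ltW.
apply: (@le_trans _ _ (\sum_(B <- meet_seq k)
   ((tent rho kappa B x != 0)%:R + (tent rho kappa B y != 0)%:R) *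
      (rho^-1 * mdist x y))).
  rewrite big_seq [leRHS]big_seq; apply: ler_sum => B /meet_seq_U[UB B0].
  rewrite -mulrBr normrM.
  apply: (@le_trans _ _ `|tent rho kappa B x - tent rho kappa B y|).
    by rewrite ler_piMl.
  have [x0'|x0'] := eqVneq (tent rho kappa B x) 0.
    have [y0|y0] := eqVneq (tent rho kappa B y) 0.
      by rewrite x0' y0 subrr normr0 addr0 mul0r.
    by rewrite add0r mul1r tent_lip.
  apply: le_trans (tent_lip rho0 kappa x y B0) _.
  by rewrite ler_peMl// lerDl.
rewrite -mulr_suml big_split/= !sum_indicator -[leRHS]mulrA ler_wpM2r//.
have := tent_count k x k2; have := tent_count k y k2.
by rewrite -!(ler_nat R); lra.
Qed.

Lemma mem_meet_seq_tent kappa k B x : kappa <= 2 -> U B -> B !=set0 ->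
  tent rho kappa B x != 0 -> mdist x0 x + r <= k%:R -> B \in meet_seq k.
Proof.
move=> k2 UB B0 h hk; have [_ [b [Bb]]] := tent_meets k2 UB B0 h.
rewrite ballEmdist/= => xb; apply/mem_meet_seq; split => //; exists b; split => //.
rewrite ballEmdist/=; have := metric_triangle x0 x b; lra.
Qed.

Let radius x : nat := (Num.truncn (mdist x0 x + r)).+1.

Let le_radius x : mdist x0 x + r <= (radius x)%:R.
Proof. by rewrite ltW// truncnS_gt. Qed.

(** The sum of the tents over all nonempty members of the cover: those that do not vanish at x
    already belong to the stage [radius x]. *)
Definition tent_total x : R := \sum_(B <- meet_seq (radius x)) tent rho 1 B x.

Lemma tent_total_mono k l x : (k <= l)%N -> mdist x0 x + r <= k%:R ->
  \sum_(B <- meet_seq l) tent rho 1 B x = \sum_(B <- meet_seq k) tent rho 1 B x.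
Proof.
move=> kl hk; apply: big_subset_supp; rewrite ?meet_seq_uniq//.
  exact: meet_seq_mono.
move=> B /meet_seq_U[UB B0] h; apply: mem_meet_seq_tent UB B0 h hk; lra.
Qed.

Lemma tent_totalE k x : mdist x0 x + r <= k%:R ->
  \sum_(B <- meet_seq k) tent rho 1 B x = tent_total x.
Proof.
move=> hk; rewrite /tent_total -(tent_total_mono (leq_maxl k (radius x)) hk).
by rewrite -(tent_total_mono (leq_maxr k (radius x)) (le_radius x)).
Qed.

Lemma tent_total_ge1 x : 1 <= tent_total x.
Proof.
have [B UB Bx] : (\bigcup_(B in U) B) x by rewrite covU.
have t1 : tent rho 1 B x = 1 by exact: tent_eq1.
have B0 : B !=set0 by exists x.
have Bs : B \in meet_seq (radius x).
  by apply: (@mem_meet_seq_tent 1 _ _ x); rewrite ?t1 ?oner_eq0//; lra.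
have -> : 1 = \sum_(B' <- [:: B]) tent rho 1 B' x by rewrite big_seq1 t1.
apply: ler_sum_subset => //; first exact: meet_seq_uniq.
  by move=> B'; rewrite inE => /eqP ->.
by move=> B'; exact: tent_ge0.
Qed.

(** A common stage represents both totals, so the stage-independent bound with all coefficients 1
    carries over. It serves to make the quotients p continuous. *)
Lemma tent_total_lip x y :
  `|tent_total x - tent_total y| <= 2 * n.+1%:R / rho * mdist x y.
Proof.
pose k := maxn (radius x) (radius y).
have hx : mdist x0 x + r <= k%:R.
  by apply: le_trans (le_radius x) _; rewrite ler_nat leq_maxl.
have hy : mdist x0 y + r <= k%:R.
  by apply: le_trans (le_radius y) _; rewrite ler_nat leq_maxr.
rewrite -(tent_totalE hx) -(tent_totalE hy).
have := @tent_sum_lip 1 k (fun=> 1) x y.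
under eq_bigr do rewrite mul1r.
under [X in _ - X]eq_bigr do rewrite mul1r.
by apply => [|B]; rewrite ?normr1//; lra.
Qed.

Lemma C0_bounded_support (f : X -> R) (M : R) : continuous f ->
  (forall x, f x != 0 -> mdist x0 x <= M) -> C0 (complexify f).
Proof.
move=> fc fM; apply/C0P; split; first exact: continuous_complexify.
move=> e e0; exists [set y : X | mdist x0 y <= M]; first exact: hproper.
move=> x /= hx; rewrite /complexify cabs_real.
by have [->|/fM//] := eqVneq (f x) 0; rewrite normr0.
Qed.

Lemma tent_bounded_support kappa k B x : kappa <= 2 -> B \in meet_seq k ->
  tent rho kappa B x != 0 -> mdist x0 x <= k%:R + diam + r.
Proof.
move=> k2 Bk h; have [UB B0] := meet_seq_U Bk.
have [_ [b [Bb hb]]] := tent_meets k2 UB B0 h.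
have [_ [a [Ba ha]]] := (mem_meet_seq k B).1 Bk.
move: ha hb; rewrite !ballEmdist/= => ha hb.
have := diamU UB Ba Bb; have := metric_triangle x0 a b.
have := metric_triangle x0 b x; rewrite (metric_sym b x); lra.
Qed.

Lemma tent_continuous kappa B : B !=set0 -> continuous (tent rho kappa B : X -> R).
Proof. by move=> B0; apply: lipschitz_continuous => x y; exact: tent_lip. Qed.

(** The narrow tents divided by their total form p, the wide tents are q. Commutators are taken with
    q alone, so the quantitative Lipschitz bound is asked of q and mere continuity of p. *)
Lemma cutoff_exists : exists (F : nat -> seq (set X)) (p q : set X -> X -> R),
  cutoff_system F p q n.+1%:R (4 * n.+1%:R / r) (diam + 2 * r).
Proof.
have tt0 x : 0 < tent_total x by exact: lt_le_trans (tent_total_ge1 x).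
exists meet_seq, (fun B x => tent rho 1 B x / tent_total x), (tent rho 2).
split.
- exact: meet_seq_uniq.
- exact: meet_seq_mono.
- move=> k B Bk; have [UB B0] := meet_seq_U Bk.
  apply: (@C0_bounded_support _ (k%:R + diam + r)) => [x|x h].
    apply: cvgM; first exact: tent_continuous.
    apply: cvgV; first by rewrite gt_eqF.
    exact: (lipschitz_continuous tent_total_lip).
  apply: (@tent_bounded_support 1 k B) => //; first by lra.
  by apply: contraNneq h => ->; rewrite mul0r.
- move=> k B Bk; have [UB B0] := meet_seq_U Bk.
  apply: (@C0_bounded_support _ (k%:R + diam + r)) => [|x h].
    exact: tent_continuous.
  exact: (@tent_bounded_support 2 k B).
- by move=> B x; rewrite divr_ge0 ?tent_ge0// ltW.
- by move=> B x; exact: tent_ge0.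
- by move=> B x; exact: tent_le1.
- move=> B x; have [->|h] := eqVneq (tent rho 1 B x) 0; first by rewrite !mul0r.
  by rewrite (tent1_tent2 h) mulr1.
- move=> k x; rewrite -mulr_suml ler_pdivrMr// mul1r.
  have h : mdist x0 x + r <= (maxn k (radius x))%:R.
    by apply: le_trans (le_radius x) _; rewrite ler_nat leq_maxr.
  rewrite -(tent_totalE h); apply: ler_sum_subset; rewrite ?meet_seq_uniq//.
    by apply: meet_seq_mono; exact: leq_maxl.
  by move=> B; exact: tent_ge0.
- move=> K cK; have [M hM] := compact_mdist_bounded x0 cK.
  (* From this stage on, mdist x0 x + r <= k at every point of K, so the partial sum is already the
     total. *)
  exists (Num.truncn (M + r)).+1 => k x hk Kx.
  rewrite -mulr_suml tent_totalE ?divff ?gt_eqF//.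
  have := hM x Kx; have := truncnS_gt (M + r); rewrite -(ler_nat R) in hk; lra.
- by move=> k x; exact: tent_sum_le.
- move=> k eps x y heps.
  have <- : 2 * n.+1%:R / rho = 4 * n.+1%:R / r :> R.
    by rewrite /rho; field; rewrite gt_eqF.
  exact: tent_sum_lip.
(* Both points lie within r of the same member, which adds 2 r to its diameter. *)
- move=> k B x y Bk hx hy; have [UB B0] := meet_seq_U Bk.
  have [_ [b [Bb hb]]] := tent_meets (lexx 2) UB B0 hx.
  have [_ [a [Ba ha]]] := tent_meets (lexx 2) UB B0 hy.
  move: ha hb; rewrite !ballEmdist/= => ha hb.
  have := diamU UB Bb Ba; have := metric_triangle x b a.
  have := metric_triangle x a y; rewrite (metric_sym a y); lra.
Qed.

End CutoffExistence.

(** * The localized operator *)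

Section NormConvergence.
Context {R : realType} {H : completeNormedModType R[i]}.

Lemma nrm_lt (v : H) (e : R[i]) : 0 < e -> (`|v| < e) = (nrm v < complex.Re e).
Proof.
move=> e0; have e1 : e = (complex.Re e)%:C%C by rewrite RRe_real// gtr0_real.
by rewrite {1}e1 nrmE ltcR.
Qed.

Lemma nrm_cvgP (u : nat -> H) (l : H) : u @ \oo --> l <->
  forall e : R, 0 < e -> exists K, forall k, (K <= k)%N -> nrm (l - u k) < e.
Proof.
split=> [/cvgrPdist_lt h e e0|h].
  have e1 : 0 < e%:C%C :> R[i] by rewrite ltcR.
  have [K _ hK] := h _ e1; exists K => k Kk.
  by have := hK k Kk; rewrite /= nrm_lt.
apply/cvgrPdist_lt => e e0.
have e1 : 0 < complex.Re e by rewrite -ltcR RRe_real// gtr0_real.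
have [K hK] := h _ e1; exists K => // k Kk /=; rewrite nrm_lt//.
exact: hK.
Qed.

Lemma nrm_cauchy_cvg (u : nat -> H) :
  (forall e : R, 0 < e -> exists K, forall k, (K <= k)%N -> nrm (u k - u K) < e) ->
  exists l : H, u @ \oo --> l.
Proof.
move=> h; exists (lim (u @ \oo)); apply: cauchy_cvg; apply: cauchy_exP => e e0.
have e1 : 0 < complex.Re e by rewrite -ltcR RRe_real// gtr0_real.
have [K hK] := h _ e1; exists (u K); exists K => // k Kk.
by rewrite /= -ball_normE/= nrm_lt// -nrmN opprB hK.
Qed.

Lemma nrm_distC (v w : H) : nrm (v - w) = nrm (w - v).
Proof. by rewrite -nrmN opprB. Qed.

Lemma nrm_triangle (u v w : H) : nrm (u - w) <= nrm (u - v) + nrm (v - w).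
Proof. by rewrite -[in leLHS](subrK v u) -addrA nrmD. Qed.

End NormConvergence.

(** * Square-sum and commutator estimates for families of functions *)

Section RepSums.
Context {R : realType} {X : metricType R} {H : completeNormedModType R[i]}.
Variables (dot : {dot H for @conjC R[i]}) (pi : (X -> R[i]) -> H -> H).
Hypothesis hdot : induces_norm dot.
Hypothesis rep : representation dot pi.
Implicit Types v w : H.

Lemma pi_real_sum (I : eqType) (s : seq I) (a : I -> R) (f : I -> X -> R) :
  (forall i, i \in s -> C0 (complexify (f i))) ->
  C0 (complexify (fun x => \sum_(i <- s) a i * f i x)) /\
  forall v, pi (complexify (fun x => \sum_(i <- s) a i * f i x)) v =
    \sum_(i <- s) (a i)%:C%C *: pi (complexify (f i)) v.
Proof.
elim: s => [|i s ih] hf.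
  have -> : complexify (fun x : X => \sum_(i <- [::]) a i * f i x) = (fun=> 0).
    by apply/funext => x; rewrite /complexify big_nil.
  by split=> [|v]; [exact: C0_0|rewrite big_nil (pi_fun0 rep)].
have [|ih1 ih2] := ih; first by move=> j js; apply: hf; rewrite inE js orbT.
have fi := hf i (mem_head _ _).
have -> : complexify (fun x => \sum_(j <- i :: s) a j * f j x) =
   (fun x => (a i)%:C%C * complexify (f i) x +
      complexify (fun x => \sum_(j <- s) a j * f j x) x).
  by apply/funext => x; rewrite /complexify big_cons rmorphD rmorphM.
split=> [|v]; first exact: C0_lin.
by rewrite (rep_linear rep)// big_cons ih2.
Qed.

(** The left side is the quadratic form of [pi] at the function \sum f_i^2, so contractivity gives a
    bound independent of the number of terms. *)
Lemma sum_nrm_pi_sq (I : eqType) (s : seq I) (f : I -> X -> R) (M : R) v :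
  (forall i, i \in s -> C0 (complexify (f i))) -> 0 <= M ->
  (forall x, \sum_(i <- s) f i x ^+ 2 <= M) ->
  \sum_(i <- s) nrm (pi (complexify (f i)) v) ^+ 2 <= M * nrm v ^+ 2.
Proof.
move=> hf M0 hM.
have f2 i : i \in s -> complexify (fun x => f i x ^+ 2) =
    (fun x => complexify (f i) x * complexify (f i) x).
  by move=> _; apply/funext => x; rewrite /complexify -rmorphM expr2.
have hf2 i : i \in s -> C0 (complexify (fun x => f i x ^+ 2)).
  by move=> si; rewrite f2//; apply: C0M; exact: hf.
have [s1 s2] := pi_real_sum (fun=> 1) hf2.
have -> : \sum_(i <- s) nrm (pi (complexify (f i)) v) ^+ 2 =
   rdot dot (pi (complexify (fun x => \sum_(i <- s) 1 * f i x ^+ 2)) v) v.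
  rewrite s2 rdot_suml; apply: eq_big_seq => i si.
  rewrite rmorph1 scale1r f2// (rep_mul rep (hf i si) (hf i si)).
  rewrite (pi_real_sym rep _ _ (hf i si)).
  by rewrite rdotvv.
apply: le_trans (rdot_le hdot _ _) _; rewrite expr2 mulrA ler_wpM2r ?nrm_ge0//.
apply: (nrm_pi_le hdot rep) => // x.
under eq_fun do under eq_bigr do rewrite mul1r.
rewrite cabs_real ger0_norm//.
by apply: sumr_ge0 => i _; exact: sqr_ge0.
Qed.

(** Dual to [sum_nrm_pi_sq]: pairing with w moves each pi f_i onto w, and Cauchy-Schwarz separates
    the two families. *)
Lemma nrm_sum_pi_le (I : eqType) (s : seq I) (f : I -> X -> R) (c : I -> H) (A : R) :
  (forall i, i \in s -> C0 (complexify (f i))) -> 0 <= A ->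
  (forall x, \sum_(i <- s) f i x ^+ 2 <= 1) ->
  \sum_(i <- s) nrm (c i) ^+ 2 <= A ^+ 2 ->
  nrm (\sum_(i <- s) pi (complexify (f i)) (c i)) <= A.
Proof.
move=> hf A0 hM hc; apply: (nrm_le_rdot hdot) => // w.
rewrite rdot_suml; apply: (@le_trans _ _
   (\sum_(i <- s) nrm (c i) * nrm (pi (complexify (f i)) w))).
  rewrite big_seq [leRHS]big_seq; apply: ler_sum => i si.
  by rewrite (pi_real_sym rep _ _ (hf i si)); exact: (rdot_le hdot).
apply: sum_CauchySchwarz => //; first exact: nrm_ge0.
by rewrite -[leRHS]mul1r; exact: sum_nrm_pi_sq.
Qed.

(** The function f / L competes in the supremum, and homogeneity restores the factor L. *)
Lemma commutator_le (T : H -> H) (f : X -> R) (l L : R) v :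
  bounded_operator T -> 0 < L -> (commutator_seminorm pi T <= l%:E)%E ->
  C0 (complexify f) -> (forall x y, `|f x - f y| <= L * mdist x y) ->
  nrm (T (pi (complexify f) v) - pi (complexify f) (T v)) <= L * l * nrm v.
Proof.
move=> [lT _] L0 hl f0 fL.
pose g x := L^-1 * f x.
have gE : complexify g = (fun x => (L^-1)%:C%C * complexify f x + 0).
  by apply/funext => x; rewrite /complexify /g rmorphM addr0.
have g0 : C0 (complexify g) by rewrite gE; apply: C0_lin => //; exact: C0_0.
have pg w : pi (complexify g) w = (L^-1)%:C%C *: pi (complexify f) w.
  by rewrite gE (rep_linear rep)//; [rewrite (pi_fun0 rep) addr0|exact: C0_0].
have gl : (lipschitz_const g <= 1)%E.
  apply: ge_ereal_sup => _ [->|[[x y] /= xy <-]]; rewrite lee_fin//.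
  have d0 : 0 < mdist x y by rewrite mdist_gt0; apply/eqP.
  rewrite ler_pdivrMr// mul1r /g -mulrBr normrM gtr0_norm ?invr_gt0//.
  by rewrite mulrC ler_pdivrMr// mulrC.
have lp := pi_linear rep g0.
have := @nrm_opnorm _ _ (fun w => T (pi (complexify g) w) - pi (complexify g) (T w)) l.
move=> /(_ _ _ v); rewrite !pg => h.
have {h} : nrm ((L^-1)%:C%C *: (T (pi (complexify f) v) - pi (complexify f) (T v)))
    <= l * nrm v.
  rewrite scalerBr -(linZ lT); apply: h.
    move=> a u w /=; rewrite !lp !lT lp scalerBr opprD !addrA; congr (_ + _).
    by rewrite -!addrA; congr (_ + _); rewrite addrC.
  apply: le_trans hl; apply: ereal_sup_ubound; exists g => //.
rewrite nrmZ gtr0_norm ?invr_gt0// mulrC ler_pdivrMr// => h.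
by rewrite -mulrA mulrC.
Qed.

End RepSums.

Section Localization.
Context {R : realType} {X : metricType R} {H : completeNormedModType R[i]}.
Variables (dot : {dot H for @conjC R[i]}) (pi : (X -> R[i]) -> H -> H).
Hypothesis hdot : induces_norm dot.
Hypothesis rep : representation dot pi.
Hypothesis nondeg : nondegenerate_rep pi.
Variables (I : eqType) (F : nat -> seq I) (p q : I -> X -> R) (N L D : R).
Hypothesis cut : cutoff_system F p q N L D.
Hypotheses (N0 : 0 <= N) (L0 : 0 < L).
Variables (T : H -> H) (l : R).
Hypothesis bT : bounded_operator T.
Hypothesis hl : (commutator_seminorm pi T <= l%:E)%E.
Hypothesis l0 : 0 <= l.
Implicit Types v w : H.

Local Notation pip i := (pi (complexify (p i))).
Local Notation piq i := (pi (complexify (q i))).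

Let lT : linear T. Proof. by case: bT. Qed.

Let sum_p k x := \sum_(i <- F k) 1 * p i x.

Let C0_sum_p k : C0 (complexify (sum_p k)).
Proof. by have [] := pi_real_sum rep (fun=> 1) (cutoff_C0p cut (k := k)). Qed.

Let pi_sum_p k v : pi (complexify (sum_p k)) v = \sum_(i <- F k) pip i v.
Proof.
have [_ ->] := pi_real_sum rep (fun=> 1) (cutoff_C0p cut (k := k)).
by apply: eq_bigr => i _; rewrite rmorph1 scale1r.
Qed.

Let sum_p_ge0 k x : 0 <= sum_p k x.
Proof.
by apply: sumr_ge0 => i _; rewrite mul1r (cutoff_p_ge0 cut).
Qed.

Let sum_p_le1 k x : sum_p k x <= 1.
Proof. by rewrite /sum_p; under eq_bigr do rewrite mul1r; exact: (cutoff_sum_p cut). Qed.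

Let sum_p_sq (s : seq I) k x : uniq s -> {subset s <= F k} ->
  \sum_(i <- s) p i x ^+ 2 <= 1.
Proof.
move=> us sF; apply: le_trans (cutoff_sum_p cut k x).
have uF := cutoff_uniq cut k; have p0 i := cutoff_p_ge0 cut i x.
apply: (@le_trans _ _ (\sum_(i <- s) p i x)); last exact: ler_sum_subset.
rewrite big_seq [leRHS]big_seq; apply: ler_sum => i si.
rewrite expr2 ler_piMl//; apply: le_trans (cutoff_sum_p cut k x).
rewrite -[leLHS](big_seq1 +%R i (fun i => p i x)); apply: ler_sum_subset => //.
by move=> j; rewrite inE => /eqP ->; exact: sF.
Qed.

Let pi_sum_p_nrm k v : nrm (pi (complexify (sum_p k)) v) <= nrm v.
Proof.
rewrite -[leRHS]mul1r; apply: (nrm_pi_le hdot rep) => // x.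
by rewrite cabs_real ger0_norm.
Qed.

(* The partition of unity acts as an approximate unit: this is where
   nondegeneracy of the representation is used. *)
Lemma partition_strong_unit v (e : R) : 0 < e -> exists k0, forall k,
  (k0 <= k)%N -> nrm (v - \sum_(i <- F k) pip i v) <= e.
Proof.
move=> e0; under eq_exists do under eq_forall do rewrite -pi_sum_p.
have lin k : linear (pi (complexify (sum_p k))) by exact: (pi_linear rep).
(* On a generator pi f w: f is small off a compact K, on which the partial sums are eventually 1, so
   (1 - \sum p_i) f is uniformly small. The denominator 1 + |w| stays positive when w = 0. *)
have gen f w (d : R) : C0 f -> 0 < d -> exists k0, forall k, (k0 <= k)%N ->
    nrm (pi f w - pi (complexify (sum_p k)) (pi f w)) <= d.
  move=> f0 d0.
  have d1 : 0 < d / (1 + nrm w) by rewrite divr_gt0// ltr_pwDl ?nrm_ge0.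
  have [_ fK] := (C0P f).1 f0; have [K cK hK] := fK _ d1.
  have [k0 hk0] := cutoff_exhaust cut cK; exists k0 => k kk.
  rewrite -(rep_mul rep (C0_sum_p k) f0).
  have f1 := C0M (C0_sum_p k) f0.
  have -> : pi f w - pi (fun x => complexify (sum_p k) x * f x) w =
      pi (fun x => -1 * (complexify (sum_p k) x * f x) + f x) w.
    by rewrite (rep_linear rep)// scaleN1r addrC.
  apply: (@le_trans _ _ (d / (1 + nrm w) * nrm w)); last first.
    rewrite mulrAC ler_pdivrMr ?ltr_pwDl ?nrm_ge0//.
    by rewrite ler_pM2l// lerDr.
  apply: (nrm_pi_le hdot rep); [exact: C0_lin|exact: ltW|move=> x].
  rewrite mulN1r addrC -[X in X - _]mul1r -mulrBl cabsM.
  rewrite -(rmorph1 (real_complex R)) -rmorphB cabs_real.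
  have [Kx|nKx] := pselect (K x).
    suff -> : sum_p k x = 1 by rewrite subrr normr0 mul0r ltW.
    by rewrite /sum_p; under eq_bigr do rewrite mul1r; exact: hk0.
  apply: le_trans (ltW (hK x nKx)); rewrite ler_piMl ?cabs_ge0//.
  by rewrite ler_norml; have := sum_p_ge0 k x; have := sum_p_le1 k x; lra.
have gens m (f : 'I_m -> X -> R[i]) (w : 'I_m -> H) (d : R) : 
    (forall j, C0 (f j)) -> 0 < d -> exists k0, forall k, (k0 <= k)%N ->
    nrm (\sum_(j < m) pi (f j) (w j) -
      pi (complexify (sum_p k)) (\sum_(j < m) pi (f j) (w j))) <= d.
  move=> hf; move: d; pose Q (u : H) := forall d : R, 0 < d ->
    exists k0, forall k, (k0 <= k)%N -> nrm (u - pi (complexify (sum_p k)) u) <= d.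
  suff : Q (\sum_(j < m) pi (f j) (w j)) by [].
  apply: big_ind => [d d0|u1 u2 h1 h2 d d0|j _ d d0].
  - by exists 0%N => k _; rewrite (lin0 (lin k)) subrr nrm0 ltW.
  - have d2 : 0 < d / 2 by rewrite divr_gt0.
    have [k1 hk1] := h1 _ d2; have [k2 hk2] := h2 _ d2.
    exists (maxn k1 k2) => k; rewrite geq_max => /andP[/hk1 a1 /hk2 a2].
    rewrite (linD (lin k)) opprD addrACA; apply: le_trans (nrmD _ _) _; lra.
  - exact: gen.
(* The thirds are for |v - w| with w a nearby finite sum of generators, for the estimate at w, and
   for the contractive partial sum applied to w - v. *)
have e3 : 0 < e / 3 by rewrite divr_gt0.
have e3c : 0 < (e / 3)%:C%C :> R[i] by rewrite ltcR.
have [] := nondeg (O := ball v (e / 3)%:C%C).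
  by exists v; exact: ballxx.
  exact: ball_open.
move=> w [hw [m [f [u [f0 wE]]]]].
have vw : nrm (v - w) < e / 3.
  by move: hw; rewrite -ball_normE/= nrm_lt.
have [k0 hk0] := gens m f u _ f0 e3; exists k0 => k kk.
have := hk0 k kk; rewrite -wE => h.
have h2 : nrm (pi (complexify (sum_p k)) w - pi (complexify (sum_p k)) v) <= nrm (v - w).
  rewrite -(linB (lin k)) (nrm_distC v w).
  exact: pi_sum_p_nrm.
have := nrm_triangle v w (pi (complexify (sum_p k)) v).
have := nrm_triangle w (pi (complexify (sum_p k)) w) (pi (complexify (sum_p k)) v).
lra.
Qed.

Definition truncation k v : H := \sum_(i <- F k) pip i (T (piq i v)).

Let linp k i : i \in F k -> linear (pip i).
Proof. by move=> Fi; apply: (pi_linear rep); exact: (cutoff_C0p cut Fi). Qed.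

Let linq k i : i \in F k -> linear (piq i).
Proof. by move=> Fi; apply: (pi_linear rep); exact: (cutoff_C0q cut Fi). Qed.

Lemma truncation_linear k : linear (truncation k).
Proof.
move=> a u v; rewrite /truncation scaler_sumr -big_split/=.
by apply: eq_big_seq => i Fi; rewrite (linq Fi) lT (linp Fi).
Qed.

(** The coefficients eps merge all the commutators into the single commutator with \sum eps_i q_i,
    whose Lipschitz constant is at most L whatever eps is. *)
Lemma sum_commutator_sq k v :
  \sum_(i <- F k) nrm (T (piq i v) - piq i (T v)) ^+ 2 <= (L * l * nrm v) ^+ 2.
Proof.
have [eps [eps1 heps]] := exists_signs hdot
  (fun i => T (piq i v) - piq i (T v)) (cutoff_uniq cut k).
apply: le_trans heps _.
have [s1 s2] := pi_real_sum rep eps (cutoff_C0q cut (k := k)).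
have -> : \sum_(i <- F k) (eps i)%:C%C *: (T (piq i v) - piq i (T v)) =
    T (pi (complexify (fun x => \sum_(i <- F k) eps i * q i x)) v) -
    pi (complexify (fun x => \sum_(i <- F k) eps i * q i x)) (T v).
  rewrite !s2; elim: (F k) => [|i s ih]; first by rewrite !big_nil (lin0 lT) subrr.
  by rewrite !big_cons ih (linD lT) (linZ lT) scalerBr opprD addrACA.
rewrite ler_pXn2r// ?nnegrE ?nrm_ge0//; last by rewrite !mulr_ge0 ?nrm_ge0// ltW.
by apply: (commutator_le rep) => // x y; exact: (cutoff_lip cut).
Qed.

Let sum_pi_le (s : seq I) k (c : I -> H) (A : R) : uniq s -> {subset s <= F k} ->
  0 <= A -> \sum_(i <- s) nrm (c i) ^+ 2 <= A ^+ 2 ->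
  nrm (\sum_(i <- s) pip i (c i)) <= A.
Proof.
move=> us sF A0 hc; apply: (nrm_sum_pi_le hdot rep) => // [i si|x].
  by apply: (cutoff_C0p cut (k := k)); exact: sF.
exact: (@sum_p_sq _ k).
Qed.

(** Since p_i q_i = p_i, the second sum is \sum p_i q_i T v, and the difference becomes \sum p_i
    [T, q_i] v. *)
Lemma truncation_commutator k v :
  nrm (truncation k v - \sum_(i <- F k) pip i (T v)) <= L * l * nrm v.
Proof.
have -> : truncation k v - \sum_(i <- F k) pip i (T v) =
    \sum_(i <- F k) pip i (T (piq i v) - piq i (T v)).
  rewrite /truncation -sumrB; apply: eq_big_seq => i Fi.
  rewrite (linB (linp Fi)); congr (_ - _).
  rewrite -(rep_mul rep (cutoff_C0p cut Fi) (cutoff_C0q cut Fi)).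
  congr (pi _ _); apply/funext => x.
  by rewrite /complexify -rmorphM (cutoff_pq cut).
apply: (@sum_pi_le _ k) => //; first exact: (cutoff_uniq cut).
  by rewrite !mulr_ge0 ?nrm_ge0// ltW.
exact: sum_commutator_sq.
Qed.

Let energy v k := \sum_(i <- F k) nrm (piq i v) ^+ 2.

Let energy_mono v : nondecreasing_seq (energy v).
Proof.
move=> k m km; apply: ler_sum_subset; rewrite ?(cutoff_uniq cut)//.
  exact: (cutoff_mono cut).
by move=> i; exact: sqr_ge0.
Qed.

Let energy_bounded v k : energy v k <= N * nrm v ^+ 2.
Proof.
apply: (sum_nrm_pi_sq hdot rep) => // [i|x]; first exact: (cutoff_C0q cut).
apply: le_trans (cutoff_sum_q cut k x); apply: ler_sum => i _.
have := cutoff_q_ge0 cut i x; have := cutoff_q_le1 cut i x; nra.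
Qed.

(** The energies \sum |q_i v|^2 increase with the stage and are bounded by N |v|^2, hence converge.
    By [sum_pi_le] an increment of the truncation is controlled by c times the square root of the
    energy increment, which gives a Cauchy sequence. *)
Lemma truncation_cvg v : exists w : H, truncation ^~ v @ \oo --> w.
Proof.
have [c c0 hc] := bounded_operatorP bT.
apply: nrm_cauchy_cvg => e e0.
have c1 : 0 < c + 1 by rewrite ltr_wpDl.
(* Chosen so that c times its square root is at most e / 2; c + 1 is positive even when c = 0. *)
have d0 : 0 < (e / 2 / (c + 1)) ^+ 2 by rewrite exprn_gt0// !divr_gt0.
have : cvgn (energy v).
  apply: nondecreasing_is_cvgn => //; exists (N * nrm v ^+ 2) => _ [k _ <-].
  exact: energy_bounded.
move=> cv; have := cv; move=> /cvgrPdist_lt/(_ _ d0)[K _ hK]; exists K => k Kk.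
have en : energy v k - energy v K <= (e / 2 / (c + 1)) ^+ 2.
  have := nondecreasing_cvgn_le (@energy_mono v) cv k.
  have := hK K (leqnn K); rewrite /= ltr_norml => /andP[_]; lra.
have uF := cutoff_uniq cut.
rewrite /truncation big_diff//; last exact: (cutoff_mono cut).
rewrite -big_filter; apply: (@le_lt_trans _ _ (e / 2)); last first.
  by rewrite ltr_pdivrMr// ltr_pMr// ltr1n.
apply: (@sum_pi_le _ k); first exact: filter_uniq.
- by move=> i; rewrite mem_filter => /andP[].
- by rewrite ltW// divr_gt0.
- rewrite big_filter.
  apply: (@le_trans _ _ (\sum_(i <- F k | i \notin F K) c ^+ 2 * nrm (piq i v) ^+ 2)).
    apply: ler_sum => i _; rewrite -exprMn ler_pXn2r ?nnegrE ?nrm_ge0//.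
    by rewrite mulr_ge0 ?nrm_ge0.
  rewrite -mulr_sumr -big_diff//; last exact: (cutoff_mono cut).
  rewrite -/(energy v k) -/(energy v K).
  apply: (@le_trans _ _ (c ^+ 2 * (e / 2 / (c + 1)) ^+ 2)).
    by rewrite ler_wpM2l// sqr_ge0.
  have e2 : 0 <= e / 2 by rewrite divr_ge0 ?ltW.
  have h : c * (e / 2 / (c + 1)) <= e / 2.
    by rewrite mulrCA ler_piMr// ler_pdivrMr// mul1r lerDl.
  have h0 : 0 <= c * (e / 2 / (c + 1)) by rewrite mulr_ge0// divr_ge0// ltW.
  by rewrite -exprMn lerXn2r ?nnegrE.
Qed.

Lemma localization_exists : exists T' : H -> H,
  [/\ bounded_operator T', forall v, truncation ^~ v @ \oo --> T' v &
      forall v, nrm (T v - T' v) <= L * l * nrm v].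
Proof.
have [c c0 hc] := bounded_operatorP bT.
have cv v : truncation ^~ v @ \oo --> (lim (truncation ^~ v @ \oo) : H).
  have [w hw] := truncation_cvg v.
  by rewrite (cvg_lim _ hw)//; exact: norm_hausdorff.
exists (fun v => lim (truncation ^~ v @ \oo)).
(* T v is compared with the partial sums of the partition of unity (e / 2), these with the
   truncation (the commutator bound), and the truncation with its limit (e / 2). *)
have est v (w : H) : truncation ^~ v @ \oo --> w -> nrm (T v - w) <= L * l * nrm v.
  move=> hw; apply/ler_addgt0Pr => e e0; have e2 : 0 < e / 2 by rewrite divr_gt0.
  have [K hK] := (nrm_cvgP _ _).1 hw _ e2.
  have [K' hK'] := partition_strong_unit (T v) e2.
  pose k := maxn K K'.
  have h1 := hK k (leq_maxl _ _); have h2 := hK' k (leq_maxr _ _).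
  rewrite nrm_distC in h1; have h3 := truncation_commutator k v.
  rewrite nrm_distC in h3.
  have h4 := nrm_triangle (T v) (\sum_(i <- F k) pip i (T v)) w.
  have h5 := nrm_triangle (\sum_(i <- F k) pip i (T v)) (truncation k v)
     w.
  lra.
have lin : linear (fun v => lim (truncation ^~ v @ \oo)).
  move=> a u v; apply: cvg_lim; first exact: norm_hausdorff.
  under eq_fun do rewrite truncation_linear.
  by apply: cvgD; [apply: cvgZr|].
split => //; last by move=> v; exact: est.
split => //.
have c1 : 0 <= c + L * l by rewrite addr_ge0// mulr_ge0// ltW.
apply: le_lt_trans (ltry (c + L * l)); apply: opnorm_le => // v.
have := nrm_triangle 0 (T v) (T v - (T v - lim (truncation ^~ v @ \oo))).
rewrite !sub0r !nrmN opprB addrCA subrr addr0 => h.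
apply: le_trans h _; rewrite mulrDl; apply: lerD => //.
by apply: est.
Qed.

End Localization.

(** * Propagation *)

Section BorelIndicator.
Context {R : realType} {H : completeNormedModType R[i]}.
Variable dot : {dot H for @conjC R[i]}.
Hypothesis hdot : induces_norm dot.

Lemma dot_proj_real (P : H -> H) v : orthogonal_projection dot P ->
  dot (P v) v = (rdot dot (P v) v)%:C%C.
Proof.
move=> hP; have [_ PP sP] := hP.
have -> : dot (P v) v = dot (P v) (P v) by rewrite -{1}(PP v) sP.
by rewrite (proj_nrm hdot hP) hdot nrmE rmorphXn.
Qed.

(* The first alternative is the default value of xget; that it does not occur
   is the spectral theorem, which is not needed. *)
Lemma borel_calculus_indic (A : H -> H) (B : set R) : measurable B ->
  borel_calculus dot A (\1_B) = (fun=> 0) \/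
  exists2 E, spectral_resolution dot A E & borel_calculus dot A (\1_B) = E B.
Proof.
move=> mB; rewrite /borel_calculus; case: xgetP => [S _|_]; last by left.
move=> [[lS _] [E res hS]]; right; exists E => //.
have pE := pvm_projection (resolution_pvm res) mB.
have [[lE _] _ _] := pE.
apply/funext => v; apply/eqP; rewrite -subr_eq0; apply/eqP; move: v.
(* Both operators have the quadratic form given by the measure of B, so polarization identifies
   them. *)
apply: (@dot_quad_eq0 _ _ _ hdot (fun v => S v - E B v)) => [a u v|v].
  by rewrite lS lE scalerBr opprD addrACA.
rewrite linearBl/= (dot_proj_real _ pE).
have [mu hmu] := pvm_sigma_additive (resolution_pvm res) v.
rewrite (hS _ _ hmu) /Rintegral integral_indic// setIT hmu//.
by rewrite subrr.
Qed.

End BorelIndicator.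

Section SpectralSupport.
Context {R : realType} {X : metricType R} {H : completeNormedModType R[i]}.
Variables (dot : {dot H for @conjC R[i]}) (pi : (X -> R[i]) -> H -> H).
Hypothesis hdot : induces_norm dot.
Hypothesis rep : representation dot pi.
Variables (g : X -> R) (l : R).
Hypothesis g0 : C0 (complexify g).
Implicit Types v w : H.

Local Notation A := (unitization_act pi g l).

Lemma unitization_linear : linear A.
Proof.
move=> a u v; rewrite /unitization_act (pi_linear rep g0) !scalerDr scalerA.
by rewrite mulrC -scalerA addrACA.
Qed.

Lemma unitization_sym v w : rdot dot (A v) w = rdot dot v (A w).
Proof. by rewrite /unitization_act rdotDl rdotDr rdotZl rdotZr (pi_real_sym rep). Qed.

(** Supplies the hypothesis on B in [proj_vanish]: an affine function of g + l need not vanish at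
    infinity, but its product with f does, so it can be iterated on the range of pi f within C_0. *)
Lemma unitization_pi (s c : R) (f : X -> R[i]) : C0 f ->
  C0 (fun x => (s * (g x + l) + c)%:C%C * f x) /\
  forall v, s%:C%C *: A (pi f v) + c%:C%C *: pi f v =
    pi (fun x => (s * (g x + l) + c)%:C%C * f x) v.
Proof.
move=> f0; have gf := C0M g0 f0.
have f1 : C0 (fun x => (s * l + c)%:C%C * f x + 0) by apply: C0_lin => //; exact: C0_0.
have -> : (fun x => (s * (g x + l) + c)%:C%C * f x) =
  (fun x => s%:C%C * (complexify g x * f x) + ((s * l + c)%:C%C * f x + 0)).
  apply/funext => x; rewrite addr0 !mulrA -rmorphM -mulrDl -rmorphD.
  by rewrite mulrDr addrA.
split=> [|v]; first exact: C0_lin.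
rewrite (rep_linear rep)// (rep_linear rep)//; last exact: C0_0.
rewrite (pi_fun0 rep) addr0 (rep_mul rep)// /unitization_act.
by rewrite rmorphD rmorphM scalerDr scalerDl addrA scalerA.
Qed.

Variables (E : set R -> H -> H).
Hypothesis res : spectral_resolution dot A E.
Let projE (B : set R) (mB : measurable B) := pvm_projection (resolution_pvm res) mB.

(* The affine function s (g + l) + c of the operator takes values in [0, r] on
   the support of psi, but is at least t on the range of E B. *)
Lemma spectral_affine_vanish (B : set R) (s c r t : R) (psi : X -> R) :
  measurable B -> C0 (complexify psi) -> (forall x, `|psi x| <= 1) ->
  0 <= r -> r < t -> (forall x, psi x != 0 -> 0 <= s * (g x + l) + c <= r) ->
  (forall v, t * nrm (E B v) ^+ 2 <=
     s * rdot dot (A (E B v)) (E B v) + c * nrm (E B v) ^+ 2) ->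
  forall v, E B (pi (complexify psi) v) = 0.
Proof.
move=> mB psi0 psi1 r0 rt hr ht; have PB := projE mB.
apply: (@proj_vanish _ _ _ _ _ hdot rep (E B)
  (fun v => s%:C%C *: A v + c%:C%C *: v) _
  (fun x => s * (g x + l) + c) r t 1) => //.
- by move=> x; rewrite cabs_real.
- by move=> f; exact: unitization_pi.
- move=> x hx; have /andP[a b] : 0 <= s * (g x + l) + c <= r.
    by apply: hr; apply: contra_neq hx => e; rewrite /complexify e.
  by rewrite ger0_norm.
- move=> v; have lE := proj_linear PB.
  rewrite (linD lE) !(linZ lE).
  by rewrite (spectral_commute hdot unitization_linear unitization_sym res).
- by move=> v; rewrite rdotDl !rdotZl rdotvv.
Qed.

Lemma spectral_gt_vanish (t D d : R) (psi : X -> R) : 0 <= d -> d + D < t ->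
  C0 (complexify psi) -> (forall x, `|psi x| <= 1) ->
  (forall x y, psi x != 0 -> psi y != 0 -> `|(g x + l) - (g y + l)| <= D) ->
  (exists2 x, psi x != 0 & g x + l <= d) ->
  forall v, E `]t, +oo[ (pi (complexify psi) v) = 0.
Proof.
move=> d0 dt psi0 psi1 osc [x hx gx].
have D0 : 0 <= D by apply: le_trans (osc x x hx hx).
(* Where psi is nonzero, g + l is within D of its value at x, so the shift by D - (g x + l) brings
   it into [0, 2 D]. On the range of the projection the shifted operator is at least t + D - (g x +
   l), which exceeds 2 D. *)
apply: (@spectral_affine_vanish _ 1 (D - (g x + l)) (2 * D) (t + (D - (g x + l)))) => //.
- by rewrite mulr_ge0.
- lra.
- move=> y hy; have := osc y x hy hx; rewrite ler_norml => /andP[]; lra.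
- move=> v; rewrite mul1r mulrDl lerD2r.
  apply: (spectral_ge hdot res) => // y; rewrite /= in_itv/= andbT.
  exact: ltW.
Qed.

Lemma spectral_le0_vanish (D d : R) (psi : X -> R) : 0 < d ->
  C0 (complexify psi) -> (forall x, `|psi x| <= 1) ->
  (forall x y, psi x != 0 -> psi y != 0 -> `|(g x + l) - (g y + l)| <= D) ->
  (forall x, psi x != 0 -> d < g x + l) ->
  forall v, E `]-oo, 0] (pi (complexify psi) v) = 0.
Proof.
move=> d0 psi0 psi1 osc hd v.
have [[x hx]|nx] := pselect (exists x, psi x != 0); last first.
  suff -> : complexify psi = (fun=> 0).
    by rewrite (pi_fun0 rep) (lin0 (proj_linear (projE _))).
  apply/funext => x; rewrite /complexify; suff -> : psi x = 0 by [].
  by apply/eqP; apply: contrapT => /negP hx; apply: nx; exists x.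
have D0 : 0 <= D by apply: le_trans (osc x x hx hx).
(* c bounds g + l from above where psi is nonzero, so c - (g + l) lies in [0, c - d] there, while on
   the range of the projection the same function of the operator is at least c. *)
pose c := g x + l + D.
apply: (@spectral_affine_vanish _ (-1) c (c - d) c) => //.
- by have := hd x hx; rewrite /c; lra.
- by lra.
- move=> y hy; have := osc y x hy hx; rewrite ler_norml => /andP[].
  by have := hd y hy; rewrite /c; lra.
- move=> w; rewrite lerDr mulN1r oppr_ge0.
  apply: le_trans (_ : 0 * nrm (E `]-oo, 0] w) ^+ 2 <= 0); last by rewrite mul0r.
  by apply: (spectral_le hdot res) => // y; rewrite /= in_itv.
Qed.

End SpectralSupport.

Lemma lipschitz_const_le1 (R : realType) (X : metricType R) (f : X -> R) x y :
  (lipschitz_const f <= 1)%E -> `|f x - f y| <= mdist x y.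
Proof.
move=> h; have [->|xy] := eqVneq x y; first by rewrite subrr normr0 mdist_ge0.
have : ((`|f x - f y| / mdist x y)%:E <= 1)%E.
  apply: le_trans h; apply: ereal_sup_ubound; right.
  by exists (x, y) => //=; apply/eqP.
by rewrite lee_fin ler_pdivrMr ?mdist_gt0// mul1r.
Qed.

Section Propagation.
Context {R : realType} {X : metricType R} {H : completeNormedModType R[i]}.
Variables (dot : {dot H for @conjC R[i]}) (pi : (X -> R[i]) -> H -> H).
Hypothesis hdot : induces_norm dot.
Hypothesis rep : representation dot pi.
Variables (I : eqType) (F : nat -> seq I) (p q : I -> X -> R) (N L D : R).
Hypothesis cut : cutoff_system F p q N L D.
Hypothesis D0 : 0 <= D.
Variables (T T' : H -> H).
Hypotheses (lT : linear T) (lT' : linear T').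
Hypothesis cvT' : forall v, (fun k => truncation pi F p q T k v) @ \oo --> T' v.

Lemma propagation_localization (delta : R) : 0 < delta ->
  (propagation dot pi T' <= (D + delta)%:E)%E.
Proof.
move=> delta0; apply: ereal_inf_lbound; exists (D + delta) => //; split.
  by rewrite addr_ge0// ltW.
move=> g l g0 gl v; set A := unitization_act pi g l.
have mN : measurable (`]-oo, 0]%classic : set R) by [].
have mP : measurable (`]D + delta, +oo[%classic : set R) by [].
have [->//|[E1 res1 ->]] := borel_calculus_indic hdot A mN.
have PE1 := pvm_projection (resolution_pvm res1) mN.
have [->|[E2 res2 ->]] := borel_calculus_indic hdot A mP.
  by rewrite (lin0 lT') (lin0 (proj_linear PE1)).
have PE2 := pvm_projection (resolution_pvm res2) mP.
set w := E2 _ v; set S := E1 _.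
have lS : linear S by exact: (proj_linear PE1).
have osc i k x y : i \in F k -> q i x != 0 -> q i y != 0 ->
    `|(g x + l) - (g y + l)| <= D.
  move=> Fi hx hy; apply: le_trans (lipschitz_const_le1 x y gl) _.
  exact: (cutoff_diam cut Fi).
have pq i x : p i x != 0 -> q i x != 0.
  by apply: contra_neq => qx; rewrite -(cutoff_pq cut) qx mulr0.
have q1 i x : `|q i x| <= 1.
  by rewrite ger0_norm ?(cutoff_q_le1 cut) ?(cutoff_q_ge0 cut).
have p1 k i x : i \in F k -> `|p i x| <= 1.
  move=> Fi; rewrite ger0_norm ?(cutoff_p_ge0 cut)//.
  apply: le_trans (cutoff_sum_p cut k x).
  rewrite -[leLHS](big_seq1 +%R i (fun i => p i x)); apply: ler_sum_subset => //.
  - exact: (cutoff_uniq cut).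
  - by move=> j; rewrite inE => /eqP ->.
  - by move=> j; exact: (cutoff_p_ge0 cut).
have d0 : 0 < delta / 2 by rewrite divr_gt0.
have term k i : i \in F k ->
    S (pi (complexify (p i)) (T (pi (complexify (q i)) w))) = 0.
  move=> Fi; have p0 := cutoff_C0p cut Fi; have q0 := cutoff_C0q cut Fi.
  (* If g + l is at most delta / 2 somewhere on the support of q_i, it stays below D + delta on that
     support, and E2 kills q_i from the right by passing to adjoints. Otherwise g + l exceeds delta
     / 2 wherever p_i is nonzero, and E1 kills p_i from the left. *)
  have [hx|nx] := pselect (exists2 x, q i x != 0 & g x + l <= delta / 2).
    suff -> : pi (complexify (q i)) w = 0.
      by rewrite (lin0 lT) (lin0 (pi_linear rep p0)) (lin0 lS).
    apply: (rdot_eq0 hdot) => u; rewrite (pi_real_sym rep _ _ q0) (proj_sym PE2).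
    rewrite (spectral_gt_vanish (D := D) hdot rep g0 res2 (ltW d0) _ q0 (q1 i) _ hx).
    - by rewrite rdotC rdot0l.
    - by lra.
    - by move=> x y; exact: osc Fi.
  apply: (spectral_le0_vanish hdot rep g0 res1 d0 p0 (p1 k i ^~ Fi)).
    by move=> x y /pq hx /pq hy; exact: (osc i k).
  move=> x /pq hx; rewrite ltNge; apply/negP => h; apply: nx.
  by exists x.
have trunc0 k : S (truncation pi F p q T k w) = 0.
  rewrite /truncation; move: (term k); elim: (F k) => [|i s ih] h.
    by rewrite big_nil (lin0 lS).
  rewrite big_cons (linD lS) h ?mem_head// add0r ih// => j js.
  by apply: h; rewrite inE js orbT.
(* S kills every truncation and is contractive, so S (T' w) is bounded by the distance from T' w to
   a truncation. *)
apply: nrm_eq0; apply/eqP; rewrite eq_le nrm_ge0 andbT.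
apply/ler_addgt0Pr => e e0; rewrite add0r.
have [K hK] := (nrm_cvgP _ _).1 (@cvT' w) _ e0.
apply: le_trans (ltW (hK K (leqnn K))).
rewrite -[X in nrm X]subr0 -(trunc0 K) -(linB lS).
exact: (proj_contract hdot PE1).
Qed.

End Propagation.

(** * Choice of the scale and conclusion *)

Lemma cutoff_system_exists (R : realType) (X : metricType R) (n : nat) :
  proper_metric X -> assouad_nagata_dim_le X n ->
  exists2 c : R, 0 < c & forall r : R, 0 < r ->
  exists (F : nat -> seq (set X)) (p q : set X -> X -> R),
  cutoff_system F p q n.+1%:R (4 * n.+1%:R / r) (c * r).
Proof.
move=> hproper [c c0 hc]; exists (c + 2); first by rewrite addr_gt0.
move=> r r0; have [U [covU diamU multU]] := hc r r0.
(* The exhaustion needs a base point; an empty space is served by the empty family. *)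
have [[x0 _]|noX] := pselect (exists x : X, True).
  by rewrite (mulrDl c); exact: (cutoff_exists hproper x0 r0 covU diamU multU).
exists (fun=> [::]), (fun _ _ => 0), (fun _ _ => 0).
split => //.
- by move=> _ x; rewrite mul0r.
- by move=> k x; case: noX; exists x.
- by move=> K _; exists 0%N => k x; case: noX; exists x.
- by move=> k x; case: noX; exists x.
- by move=> k eps x; case: noX; exists x.
Qed.

Theorem theorem3p16 (R : realType) (X : metricType R) (n : nat)
    (hproper : proper_metric X) (hdim : assouad_nagata_dim_le X n) :
  exists2 C : R, 0 < C &
    forall (H : completeNormedModType R[i]) (dot : {dot H for @conjC R[i]})
      (hdot : induces_norm dot)
      (pi : (X -> R[i]) -> H -> H),
      representation dot pi -> faithful pi -> nondegenerate_rep pi ->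
      forall T : H -> H, bounded_operator T ->
      forall alpha : R, 0 < alpha ->
      exists T' : H -> H,
        [/\ bounded_operator T',
            (opnorm (fun v => (T v - T' v)%R) < alpha%:E)%E &
            (propagation dot pi T' <=
              C%:E * (commutator_seminorm pi T * (alpha^-1)%:E))%E].
Proof.
have [c c0 hcut] := cutoff_system_exists hproper hdim.
(* Propagation at scale r is at most (c + 1) r, and r = 8 (n+1) l / alpha brings the error 4 (n+1) l
   / r down to alpha / 2. *)
exists ((c + 1) * (8 * n.+1%:R)); first by rewrite mulr_gt0 ?addr_gt0// mulr_gt0.
move=> H dot hdot pi rep _ nondeg T bT alpha alpha0.
have sem0 : (0 <= commutator_seminorm pi T)%E.
  apply: le_trans (ereal_sup_ubound _); last first.
    exists (fun=> 0) => //; split; first exact: C0_0.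
    apply: ge_ereal_sup => _ [->|[[x y] /= xy <-]]; rewrite lee_fin//.
    by rewrite subrr normr0 mul0r.
  apply: le_trans (ereal_sup_ubound _); last by exists 0 => //=; rewrite normr0.
  by rewrite lee_fin nrm_ge0.
(* The propagation slack delta is taken equal to r, on top of the support diameter c r. *)
have local (l r : R) : 0 <= l -> (commutator_seminorm pi T <= l%:E)%E -> 0 < r ->
    exists T' : H -> H, [/\ bounded_operator T',
      forall v, nrm (T v - T' v) <= 4 * n.+1%:R / r * l * nrm v &
      (propagation dot pi T' <= ((c + 1) * r)%:E)%E].
  move=> l0 hl r0; have [F [p [q cut]]] := hcut r r0.
  have L0 : 0 < 4 * n.+1%:R / r :> R by rewrite divr_gt0// mulr_gt0.
  have [T' [bT' cvT' est]] :=
    localization_exists hdot rep nondeg cut (ler0n _ _) L0 bT hl l0.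
  exists T'; split => //; rewrite mulrDl mul1r.
  apply: (propagation_localization hdot rep cut _ _ _ cvT') => //.
  - by rewrite mulr_ge0 ?ltW.
  - by case: bT.
  - by case: bT'.
(* When the seminorm is infinite the propagation bound is +oo and T' = T works. *)
case E : (commutator_seminorm pi T) sem0 => [l| |] // sem0; last first.
  exists T; split => //.
    apply: (@le_lt_trans _ _ 0%:E); last by rewrite lte_fin.
    by apply: opnorm_le => // v; rewrite subrr nrm0 mul0r.
  rewrite gt0_mulye ?lte_fin ?invr_gt0// gt0_muley ?leey// lte_fin.
  by rewrite mulr_gt0 ?addr_gt0// mulr_gt0.
rewrite lee_fin in sem0; have hl : (commutator_seminorm pi T <= l%:E)%E by rewrite E.
(* With l = 0 the scale 8 (n+1) l / alpha degenerates. Here every localization equals T, as the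
   error bound is 0, so scales tending to 0 show that T itself has propagation at most 0. *)
have [l0|l0] := eqVneq l 0.
  exists T; split => //.
    apply: (@le_lt_trans _ _ 0%:E); last by rewrite lte_fin.
    by apply: opnorm_le => // v; rewrite subrr nrm0 mul0r.
  rewrite l0 mul0e mule0; apply/lee_addgt0Pr => e e0; rewrite add0e.
  have r0 : 0 < e / (c + 1) by rewrite divr_gt0// addr_gt0.
  have [T' [_ est prT']] := local l _ sem0 hl r0.
  suff -> : T = T'.
    apply: le_trans prT' _; rewrite lee_fin mulrC divfK// gt_eqF// addr_gt0//.
  apply/funext => v; apply/eqP; rewrite -subr_eq0; apply/eqP; apply: nrm_eq0.
  apply/eqP; rewrite eq_le nrm_ge0 andbT; apply: le_trans (est v) _.
  by rewrite l0 mulr0 mul0r.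
have lp : 0 < l by rewrite lt_neqAle eq_sym l0.
have r0 : 0 < 8 * n.+1%:R * l / alpha by rewrite divr_gt0// !mulr_gt0.
have [T' [bT' est prT']] := local l _ sem0 hl r0.
exists T'; split => //.
  apply: (@le_lt_trans _ _ (alpha / 2)%:E); last first.
    by rewrite lte_fin ltr_pdivrMr// ltr_pMr// ltr1n.
  apply: opnorm_le => [|v]; first by rewrite divr_ge0// ltW.
  suff <- : 4 * n.+1%:R / (8 * n.+1%:R * l / alpha) * l = alpha / 2 by exact: est.
  by field; rewrite !gt_eqF ?ltr0n.
by apply: le_trans prT' _; rewrite -!EFinM lee_fin !mulrA.
Qed.
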